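(* Let $G$ be a countable, finitely generated amenable group, let $A$ be a finite set, and let $\mathcal{F}$ be a strongly-stable class of shifts over $G$. (i) If $\mathfrak{S}^{\mathcal{F}}$ is a $G_\delta$ subset of $\mathfrak{S}$, then for every $c\ge 0$ the set $\mathfrak{S}^{\mathcal{F}}_{c}$ is comeagre in $\mathfrak{S}^{\mathcal{F}}_{\ge c}$. (ii) More generally, when $\mathfrak{S}^{\mathcal{F}}$ is not necessarily a $G_\delta$, for every $c\ge 0$ and $\varepsilon>0$, the set of shifts in $\mathfrak{S}^{\mathcal{F}}_{\ge c}$ with entropy in $[c,c+\varepsilon)$ is dense in $\mathfrak{S}^{\mathcal{F}}_{\ge c}$.
   Context: For a finite set $A$, $A^G$ carries the product topology ($A$ discrete), and $G$ acts on it by $[gx](h)=x(g^{-1}h)$. A shift is a closed $G$-invariant subset $X\subseteq A^G$. For finite $K\subset G$, $x_K$ is the restriction of $x$ to $K$ and $X_K=\{x_K : x\in X\}$. The space $\mathfrak{S}$ of all shifts in $A^G$ has the Hausdorff topology, which is compact and Polish; $X^n\to X$ if and only if for every finite $K\subset G$ one has $X^n_K=X_K$ for all large enough $n$. Fix a left-invariant word metric $d$ on $G$, and let $B_r=\{g\in G: d(e,g)\le r\}$. For finite $F\subset G$ let $\partial_rF=\{g\in G: gB_r\cap F\ne\emptyset \text{ and } gB_r\cap(G\setminus F)\neq\emptyset\}$ and $\rho_r(F)=|\partial_rF|/|F|$. A sequence $(F_n)$ of finite subsets of $G$ is Følner if $\lim_n\rho_r(F_n)=0$ for every $r\in\mathbb{N}$.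 The entropy of a shift $X$ is $h(X)=\lim_{n\to\infty}\frac{1}{|F_n|}\log|X_{F_n}|$ for any Følner sequence $(F_n)$ (the limit exists and does not depend on the sequence). A shift $X$ is strongly irreducible if there is $r\in\mathbb{N}$ such that for all finite $K,H\subset G$ with $d(k,h)>r$ for all $k\in K$, $h\in H$, and all $x,y\in X$, there is $z\in X$ with $z_K=x_K$ and $z_H=y_H$. A factor of a shift $X$ is a shift (over any finite alphabet) that is the image of $X$ under a continuous $G$-equivariant map. The product of shifts $X\subseteq A^G$ and $Y\subseteq B^G$ is regarded as a shift over the alphabet $A\times B$. A class $\mathcal{F}$ of shifts over $G$ (over arbitrary finite alphabets) is strongly-stable if it is closed under taking factors and under taking products with strongly irreducible shifts. $\mathfrak{S}^{\mathcal{F}}$ is the set of shifts in $\mathfrak{S}$ that belong to $\mathcal{F}$, with the subspace topology; $\mathfrak{S}^{\mathcal{F}}_{\ge c}=\{X\in\mathfrak{S}^{\mathcal{F}}: h(X)\ge c\}$ and $\mathfrak{S}^{\mathcal{F}}_{c}=\{X\in\mathfrak{S}^{\mathcal{F}}: h(X)= c\}$. A subset of a topological space is comeagre if it contains a dense $G_\delta$ subset.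
   Formalization: The group G is additionally assumed to be infinite; for finite G (e.g. trivial G, |A| = 2, all shifts, 0 < c < log 2) the set of shifts with entropy at least c is just the full shift and none has entropy c, so the claim fails. *)

(* Defs.v *)
From HB Require Import structures.
From mathcomp Require Import all_boot all_order all_algebra finmap.
From mathcomp Require Import all_classical all_reals all_analysis.
From mathcomp Require Import borel_hierarchy.

Set Implicit Arguments.
Unset Strict Implicit.
Unset Printing Implicit Defensive.

Import Order.TTheory GRing.Theory Num.Theory numFieldNormedType.Exports.

Local Open Scope classical_set_scope.
Local Open Scope ring_scope.

(* A subset of a topological space is comeagre if it contains a dense Gdelta.
   Relative notions ("comeagre in Y", "dense in Y") are obtained by taking for
   T the subtype [set_type Y], which carries the subspace topology. *)
Definition comeagre (T : topologicalType) (M : set T) : Prop :=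
  exists D : set T, [/\ Gdelta D, dense D & D `<=` M].

(* The Hausdorff uniformity on the subsets of a uniform space: a basic
   entourage relates X and Y when each is contained in the E-neighbourhood of
   the other.  On the closed subsets of a compact metric space it is the
   uniformity of the Hausdorff metric; the empty set is an isolated point. *)
Section Hausdorff.
Local Open Scope relation_scope.
Variable T : uniformType.

Definition hyperspace : Type := set T.

HB.instance Definition _ := Choice.copy hyperspace (set T).

Definition hausdorff_rel (E : set (T * T)) : set (hyperspace * hyperspace) :=
  [set XY | (forall x, XY.1 x -> exists2 y, XY.2 y & E (x, y)) /\
            (forall y, XY.2 y -> exists2 x, XY.1 x & E (x, y))].

Definition hausdorff_entourage : set_system (hyperspace * hyperspace) :=
  filter_from entourage hausdorff_rel.

Lemma hausdorff_rel_mono (D E : set (T * T)) :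
  D `<=` E -> hausdorff_rel D `<=` hausdorff_rel E.
Proof.
move=> DE [X Y] [/= XY YX]; split=> /= u.
  by move=> /XY[v Yv Duv]; exists v => //; exact: DE.
by move=> /YX[v Xv Dvu]; exists v => //; exact: DE.
Qed.

Lemma hausdorff_entourage_filter : Filter hausdorff_entourage.
Proof.
apply: filter_from_filter; first by exists setT; exact: entourageT.
move=> D E entD entE; exists (D `&` E); first exact: filterI.
by move=> XY DEXY; split; apply: hausdorff_rel_mono DEXY => u [].
Qed.

Lemma hausdorff_entourage_diagonal A :
  hausdorff_entourage A -> diagonal `<=` A.
Proof.
move=> [E entE EA] [X Y] /diagonalP ->; apply: EA; split=> /= x Yx;
  by exists x => //; exact: entourage_refl.
Qed.

Lemma hausdorff_entourage_inv A :
  hausdorff_entourage A -> hausdorff_entourage A^-1.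
Proof.
move=> [E entE EA]; exists E^-1; first exact: entourage_inv.
move=> [X Y] [/= XY YX]; apply: EA; split=> /= u.
  by move=> /YX[v]; exists v.
by move=> /XY[v]; exists v.
Qed.

Lemma hausdorff_entourage_split A : hausdorff_entourage A ->
  exists2 B, hausdorff_entourage B & B \; B `<=` A.
Proof.
move=> [E entE EA]; have [D entD DE] := entourage_split_ex entE.
exists (hausdorff_rel D); first by exists D.
move=> [X Z] [Y [/= XY YX] [/= YZ ZY]]; apply: EA; split=> /= u.
  by move=> /XY[v /YZ[w Zw Dvw] Duv]; exists w => //; apply: DE; exists v.
by move=> /ZY[v /YX[w Xw Dwv] Dvu]; exists w => //; apply: DE; exists v.
Qed.

HB.instance Definition _ := @isUniform.Build hyperspace hausdorff_entourage
  hausdorff_entourage_filter hausdorff_entourage_diagonal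
  hausdorff_entourage_inv hausdorff_entourage_split.

End Hausdorff.

Notation config G A := {ptws G -> discrete_topology A}.

Section WordMetric.
Variables (G : groupType) (S : {fset G}).

Definition is_word (n : nat) (g : G) : Prop :=
  exists s : seq G, [/\ size s = n,
    all (fun x => (x \in S) || (x^-1%g \in S)) s & (\prod_(x <- s) x)%g = g].

Definition generates : Prop := forall g : G, exists n, is_word n g.

(* 0 by convention outside the subgroup generated by S *)
Definition word_length (g : G) : nat :=
  match pselect (exists n, `[< is_word n g >]) with
  | left e => ex_minn e
  | right _ => 0%N
  end.

Definition word_dist (g h : G) : nat := word_length (g^-1 * h)%g.

Definition ball_at1 (r : nat) : set G := [set g | (word_dist 1%g g <= r)%N].

Definition boundary (r : nat) (F : {fset G}) : set G :=
  [set g : G | let gB := (fun b => g * b)%g @` ball_at1 r in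
     gB `&` [set` F] !=set0 /\ gB `&` ~` [set` F] !=set0].

(* [fset_set] of an infinite set is empty, but when S generates G the balls,
   hence the boundaries of finite sets, are finite. *)
Definition rho (R : realType) (r : nat) (F : {fset G}) : R :=
  #|` fset_set (boundary r F)|%:R / #|` F|%:R.

(* Nonemptiness is implicit in dividing by |F|; without it the empty sets
   would qualify, since x / 0 = 0 here. *)
Definition folner (R : realType) (F : nat -> {fset G}) : Prop :=
  (forall n, F n != fset0) /\ forall r, rho R r (F n) @[n --> \oo] --> (0 : R).

Definition amenable (R : realType) : Prop :=
  exists F : nat -> {fset G}, folner R F.

End WordMetric.

Section Shifts.
Variable G : groupType.

Definition translate (A : finType) (g : G) (x : config G A) : config G A :=
  fun h => x (g^-1 * h)%g.

Record subshift (A : finType) := Shift {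
  shift_set :> set (config G A);
  shift_closed : closed shift_set;
  shift_invariant : forall g x, shift_set x -> shift_set (translate g x) }.

HB.instance Definition _ (A : finType) := gen_eqMixin (subshift A).
HB.instance Definition _ (A : finType) := gen_choiceMixin (subshift A).

Definition to_hyperspace (A : finType) (X : subshift A) :
  hyperspace (config G A) := shift_set X.

(* The space of all shifts, as a subspace of the hyperspace of A^G. *)
HB.instance Definition _ (A : finType) :=
  Uniform.copy (subshift A) (initial_topology (@to_hyperspace A)).

Lemma subshift_eq (A : finType) (X Y : subshift A) :
  shift_set X = shift_set Y -> X = Y.
Proof.
case: X Y => [X cX iX] [Y cY iY] /= XY; move: cX iX cY iY; rewrite XY.
by move=> *; congr Shift; exact: Prop_irrelevance.
Qed.

Definition pattern (A : finType) (K : {fset G}) (x : config G A) :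
  {ffun K -> A} := [ffun k => x (val k)].

Definition patterns (A : finType) (K : {fset G}) (X : set (config G A)) :
  set {ffun K -> A} := pattern K @` X.

Arguments patterns {A} K X _.

Lemma patternP (A : finType) (K : {fset G}) (x y : config G A) :
  pattern K x = pattern K y <-> {in K, x =1 y}.
Proof.
split=> [/ffunP xy k kK | xy]; first by have := xy [` kK]%fset; rewrite !ffunE.
by apply/ffunP => k; rewrite !ffunE; exact/xy/valP.
Qed.

Definition agree (A : finType) (K : {fset G}) :
  set (config G A * config G A) := [set xy : config G A * config G A | {in K, xy.1 =1 xy.2}].

Arguments agree : clear implicits.

Lemma config_entourageP (A : finType) (E : set (config G A * config G A)) :
  entourage E <->
  exists K : {fset G}, forall x y, {in K, x =1 y} -> E (x, y).
Proof.
split.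
  move=> [_ [F _ <-] FE].
  have finF : finite_set [set ((sval p).1 : G) | p in [set` F]].
    exact/finite_image/finite_fset.
  exists (fset_set [set ((sval p).1 : G) | p in [set` F]]) => x y xy.
  apply: FE => p /= pF; have := svalP p => /= /asboolP[V entV VD].
  have xyp : x (sval p).1 = y (sval p).1.
    by apply: xy; rewrite in_fset_set//; apply/mem_set; exists p.
  apply: VD => /=; apply: entV; exists (x (sval p).1) => //.
  by rewrite /unstable.map_pair /proj /= xyp.
move=> [K KE]; apply: filterS (_ : entourage
  (\bigcap_(k in [set` K]) [set xy : config G A * config G A | xy.1 k = xy.2 k])).
  by move=> [x y] xy; apply: KE => k kK; exact: (xy k).
apply: filter_bigI => k _.
pose D := [set xy : config G A * config G A | xy.1 k = xy.2 k].
have entD : `[< @entourage (initial_topology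
    (@proj _ (fun _ : G => discrete_topology A) k)) D >].
  apply/asboolP; exists diagonal; first by move=> _ [x _ <-].
  by move=> [x y] /diagonalP.
exists D => //; exists [fset exist _ (k : {classic G}, D) entD]%fset.
  by move=> p _; rewrite inE.
by rewrite set_fset1 bigcap_set1.
Qed.

Lemma nbhs_configP (A : finType) (x : config G A) (U : set (config G A)) :
  nbhs x U <-> exists K : {fset G}, forall y, {in K, x =1 y} -> U y.
Proof.
rewrite -nbhs_entourageE; split=> [[E /config_entourageP[K KE] EU] | [K KU]].
  by exists K => y /KE Exy; apply: EU; exact/mem_set.
exists (agree A K); first by apply/config_entourageP; exists K.
by move=> y /set_mem /= /KU.
Qed.

Lemma hausdorff_patterns (A : finType) (K : {fset G}) (X Y : set (config G A)) :
  hausdorff_rel (agree A K) (X, Y) <->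
  patterns K X = patterns K Y.
Proof.
split=> [[/= XY YX] | XY]; last first.
  split=> /= [x Xx | y Yy].
    have : patterns K X (pattern K x) by exists x.
    by rewrite XY => -[y Yy /esym/patternP xy]; exists y.
  have : patterns K Y (pattern K y) by exists y.
  by rewrite -XY => -[x Xx /patternP xy]; exists x.
apply/seteqP; split=> _ [x Xx <-].
  by have [y Yy /patternP xy] := XY x Xx; exists y.
by have [y Yy /patternP xy] := YX x Xx; exists y.
Qed.

Lemma nbhs_subshiftP (A : finType) (X : subshift A) (U : set (subshift A)) :
  nbhs X U <->
  exists K : {fset G}, forall Y : subshift A, patterns K X = patterns K Y -> U Y.
Proof.
rewrite -nbhs_entourageE; split.
  move=> [V [W [E /config_entourageP[K KE] EH] HV] VU]; exists K => Y XY.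
  apply: VU; apply/mem_set/HV/EH.
  by apply: (hausdorff_rel_mono _ (proj2 (hausdorff_patterns _ _ _) XY)) => -[x y] /KE.
move=> [K KU]; pose E := agree A K.
exists [set XY : subshift A * subshift A |
    hausdorff_rel E (to_hyperspace XY.1, to_hyperspace XY.2)].
  exists (hausdorff_rel E); last by [].
  by exists E => //; apply/config_entourageP; exists K.
by move=> Y /set_mem/hausdorff_patterns; exact: KU.
Qed.

Lemma cvg_subshiftP (A : finType) (X : nat -> subshift A) (L : subshift A) :
  X n @[n --> \oo] --> L <->
  forall K : {fset G}, \forall n \near \oo, patterns K (X n) = patterns K L.
Proof.
split=> [XL K | XL U /nbhs_subshiftP[K KU]].
  by apply: (XL [set Y | patterns K Y = patterns K L]);
    apply/nbhs_subshiftP; exists K.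
by apply: filterS (XL K) => n /esym; exact: KU.
Qed.

Section Product.
Variables (A B : finType) (X : subshift A) (Y : subshift B).

Definition prod_config : set (config G (A * B)%type) :=
  [set z | shift_set X (fst \o z) /\ shift_set Y (snd \o z)].

Lemma prod_config_closed : closed prod_config.
Proof.
move=> z clz; split; [apply: (shift_closed (s := X)) | apply: (shift_closed (s := Y))];
  move=> U /nbhs_configP[K KU].
  have [w [[Xw Yw] zw]] : prod_config `&` [set w | {in K, z =1 w}] !=set0.
    by apply: clz; apply/nbhs_configP; exists K.
  by exists (fst \o w); split=> //; apply: KU => k /zw /= ->.
have [w [[Xw Yw] zw]] : prod_config `&` [set w | {in K, z =1 w}] !=set0.
  by apply: clz; apply/nbhs_configP; exists K.
by exists (snd \o w); split=> //; apply: KU => k /zw /= ->.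
Qed.

Lemma prod_config_invariant g z : prod_config z -> prod_config (translate g z).
Proof.
by move=> [Xz Yz]; split; [exact: (shift_invariant (s := X) g Xz)
  | exact: (shift_invariant (s := Y) g Yz)].
Qed.

Definition prod_shift : subshift (A * B)%type :=
  Shift prod_config_closed prod_config_invariant.

End Product.

Definition is_factor (A B : finType) (X : subshift A) (Y : subshift B) : Prop :=
  exists phi : set_type X -> config G B,
    [/\ continuous phi,
        forall (g : G) (x y : set_type X),
          set_val y = translate g (set_val x) -> phi y = translate g (phi x) &
        range phi = Y].

Definition strongly_irreducible (S : {fset G}) (A : finType) (X : subshift A) :
    Prop :=
  exists r : nat, forall K H : {fset G},
    (forall k h, k \in K -> h \in H -> (r < word_dist S k h)%N) ->
    forall x y, shift_set X x -> shift_set X y -> exists z,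
      [/\ shift_set X z, pattern K z = pattern K x & pattern H z = pattern H y].

(* With lne 0 = -oo, the empty shift has entropy -oo. *)
Definition pattern_entropy (R : realType) (A : finType) (K : {fset G})
    (X : subshift A) : \bar R :=
  ((#|` K|%:R^-1)%:E * lne (#|` fset_set (patterns K X)|%:R)%:E)%E.

Definition entropy (R : realType) (S : {fset G}) (A : finType) (X : subshift A) :
    \bar R :=
  xget -oo%E [set h : \bar R | forall F : nat -> {fset G}, folner S R F ->
    pattern_entropy R (F n) X @[n --> \oo] --> h].

Definition shift_class : Type := forall A : finType, set (subshift A).

Definition strongly_stable (S : {fset G}) (F : shift_class) : Prop :=
  (forall (A B : finType) (X : subshift A) (Y : subshift B),
     F A X -> is_factor X Y -> F B Y) /\
  (forall (A B : finType) (X : subshift A) (Y : subshift B),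
     F A X -> strongly_irreducible S Y -> F (A * B)%type (prod_shift X Y)).

Definition shifts_ge (R : realType) (S : {fset G}) (F : shift_class)
    (A : finType) (c : R) : set (subshift A) :=
  [set X | F A X /\ (c%:E <= entropy R S X)%E].

Definition shifts_eq (R : realType) (S : {fset G}) (F : shift_class)
    (A : finType) (c : R) : set (subshift A) :=
  [set X | F A X /\ entropy R S X = c%:E].

End Shifts.

Arguments agree {G} A K _.
Arguments patterns {G A} K X _.
Arguments shifts_ge {G R} S F A c _.
Arguments shifts_eq {G R} S F A c _.

(* Main.v *)
(** By Shearer's inequality the entropy of a shift X is the infimum over all finite
    nonempty E of log |X_E| / |E|. Hence entropy is upper semicontinuous, and (i)
    follows from (ii) by a Baire category argument in which the limit shift is
    obtained by compactness.

    For (ii), let X have entropy at least c and fix a finite K. For every finite P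
    and every delta > 0 there is a shift C of entropy at most delta, a factor of a
    strongly irreducible shift, whose elements colour G so that distinct points
    related by P have distinct colours: colour g by its position relative to a
    nearby point of a sparse maximal separated set, and by a colour of that point.
    Given x in X and c in C, run through the colours repeatedly; at each point g of
    the current colour, replace x on the window gF by the filling of least energy
    among the locally admissible ones that agree with x near the boundary of the
    window and near the points of one distinguished colour. After i steps the
    images of X form a factor X_i of the product of X with a strongly irreducible
    shift, with the same K-patterns as X. A single step lowers the entropy of the
    pairs (x_i, c) by at most delta, since points of one colour are sparse. Each
    change lowers an energy that is bounded per site, so on a large Følner set one
    of many passes makes few changes; the windows left unchanged by a pass are
    determined by their frozen sites, and Shearer's inequality bounds the final
    entropy by a multiple of delta. Therefore some X_i has entropy in [c, c + eps). *)

Require Import Defs.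
From mathcomp Require Import all_boot all_order all_algebra finmap.
From mathcomp Require Import all_classical all_reals all_analysis.
From mathcomp Require Import borel_hierarchy.
From mathcomp Require Import lra zify.

Set Implicit Arguments.
Unset Strict Implicit.
Unset Printing Implicit Defensive.

Import Order.TTheory GRing.Theory Num.Theory numFieldNormedType.Exports.

Local Open Scope classical_set_scope.
Local Open Scope ring_scope.

(** * Counting values and Shearer's inequality *)

Section Values.
Variable T : Type.
Implicit Types (D : set T) (B C : finType).

(** The logarithm of this number is a counting version of Shannon entropy: monotone under functional
    dependence ([leq_nval_fun]) and subadditive on pairs ([nval_pair]). *)
Definition nval B D (f : T -> B) : nat := #|[pred b : B | `[< (f @` D) b >]]|.

Lemma nvalP B D (f : T -> B) b :
  reflect (exists2 x, D x & f x = b) (b \in [pred b : B | `[< (f @` D) b >]]).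
Proof. by rewrite inE; exact: asboolP. Qed.

Lemma leq_nval_fun B C D (f : T -> B) (g : T -> C) :
  (forall x y, D x -> D y -> g x = g y -> f x = f y) ->
  (nval D f <= nval D g)%N.
Proof.
move=> fg; have [[x0 _]|D0] := EM (D !=set0).
  have /choice[h hP] (c : C) : exists b, forall x, D x -> g x = c -> f x = b.
    have [[x [Dx gx]]|ng] := EM (exists x, D x /\ g x = c).
      by exists (f x) => y Dy gy; apply: fg; rewrite ?gx ?gy.
    by exists (f x0) => x Dx gx; case: ng; exists x.
  have hg x (Dx : D x) : h (g x) = f x by rewrite -(hP (g x) x).
  apply: leq_trans (leq_image_card h _); apply/subset_leq_card/fintype.subsetP => b.
  case/nvalP => x Dx <-; rewrite -(hg x Dx).
  by apply/fintype.imageP; exists (g x) => //; apply/nvalP; exists x.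
rewrite /nval eq_card0// => b; apply/negP => /nvalP[x Dx _].
by apply: D0; exists x.
Qed.

Lemma leq_nval_sub B D D' (f : T -> B) : D `<=` D' -> (nval D f <= nval D' f)%N.
Proof.
move=> DD; apply/subset_leq_card/fintype.subsetP => b /nvalP[x Dx fx].
by apply/nvalP; exists x => //; exact: DD.
Qed.

Lemma nval_le_card B D (f : T -> B) : (nval D f <= #|B|)%N.
Proof. exact: max_card. Qed.

Lemma nval_gt0 B D (f : T -> B) : (0 < nval D f)%N <-> D !=set0.
Proof.
split=> [/card_gt0P[b /nvalP[x Dx _]]|[x Dx]]; first by exists x.
by apply/card_gt0P; exists (f x); apply/nvalP; exists x.
Qed.

Lemma leq_nval_fiber B C D (f : T -> B) (g : T -> C) :
  (nval D f <= \sum_c nval (D `&` [set x | g x = c]) f)%N.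
Proof.
rewrite /nval -sum1_card.
apply: (@leq_trans (\sum_(b in [pred b : B | `[< (f @` D) b >]])
   \sum_c (b \in [pred b : B | `[< (f @` (D `&` [set x | g x = c])) b >]]))%N).
  apply: leq_sum => b /nvalP[x Dx fx]; rewrite (bigD1 (g x))//=.
  suff -> : b \in [pred b | `[<(f @` (D `&` [set x0 | g x0 = g x])) b>]] by [].
  by apply/nvalP; exists x.
rewrite exchange_big; apply: leq_sum => c _ /=.
rewrite [leqRHS](_ : _ = \sum_b (b \in [pred b | `[<(f @` (D `&` [set x | g x = c])) b>]]))%N; last first.
  by rewrite -sum1_card big_mkcond/=; apply: eq_bigr => b _; case: ifP.
by rewrite big_mkcond; apply: leq_sum => b _; case: ifP.
Qed.

Lemma leq_nval_fiber_const B C D (f : T -> B) (g : T -> C) k (P : pred C) :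
  (forall x, D x -> P (g x)) ->
  (forall c, P c -> (nval (D `&` [set x | g x = c]) f <= k)%N) ->
  (nval D f <= #|P| * k)%N.
Proof.
move=> DP Pk; apply: leq_trans (leq_nval_fiber D f g) _.
rewrite -sum1_card big_distrl/= [leqRHS]big_mkcond/=; apply: leq_sum => c _.
case: ifP => [cP|cP]; first by rewrite mul1n; exact: Pk.
rewrite leqn0 -leqn0 leqNgt; apply/negP => /nval_gt0[x [Dx gx]].
by move/negP: cP; apply; rewrite -gx; exact: DP.
Qed.

Lemma nval_pair B C D (f : T -> B) (g : T -> C) :
  (nval D (fun x => (f x, g x)) <= nval D f * nval D g)%N.
Proof.
rewrite /nval -cardX; apply/subset_leq_card/fintype.subsetP => -[b c] /nvalP[x Dx [<- <-]].
by rewrite inE/=; apply/andP; split; apply/nvalP; exists x.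
Qed.

End Values.

Lemma nval_image (T U : Type) (B : finType) (D : set T) (h : T -> U) (f : U -> B) :
  nval (h @` D) f = nval D (f \o h).
Proof.
apply: eq_card => b; apply/nvalP/nvalP.
  by move=> [_ [x Dx <-] <-]; exists x.
by move=> [x Dx <-]; exists (h x) => //; exists x.
Qed.

(* Hölder's inequality with exponents [1/k], raised to the power [k]; it follows
   from AM-GM applied to the ratios [u i j / s j]. *)
Lemma holder_nat (R : realType) (I J : finType) (k : nat) (m : I -> nat)
    (u : I -> J -> nat) (s : J -> nat) (P : {pred J}) :
  (0 < k)%N -> #|P| = k ->
  (forall i, m i ^ k <= \prod_j u i j)%N ->
  (forall j, j \in P -> \sum_i u i j <= s j)%N ->
  (forall i j, j \notin P -> u i j <= s j)%N ->
  ((\sum_i m i) ^ k <= \prod_j s j)%N.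
Proof.
move=> k0 Pk mu us us'.
have ule i j : (u i j <= s j)%N.
  have [jP|/us'//] := boolP (j \in P).
  by apply: leq_trans (us j jP); rewrite (bigD1 i)//= leq_addr.
have [/existsP[j /eqP sj]|/existsPn s0] := boolP [exists j, s j == 0%N].
  rewrite big1 ?exp0n// => i _; apply/eqP.
  have := mu i; rewrite (bigD1 j)//=.
  have -> : u i j = 0%N by apply/eqP; rewrite -leqn0 -sj.
  by rewrite mul0n leqn0 expn_eq0 k0 andbT.
have spos j : (0 : R) < (s j)%:R by rewrite ltr0n lt0n s0.
pose S : R := \prod_j (s j)%:R.
have S0 : 0 <= S by apply: prodr_ge0.
(* It suffices to show [m i <= p * w i], where [p] is the [k]-th root of the product of the [s j]
   and the weights [w i] sum to at most 1. *)
pose p : R := S `^ (k%:R^-1).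
have pS : p ^+ k = S.
  rewrite -powR_mulrn ?powR_ge0// -powRrM mulVf ?powRr1//.
  by rewrite pnatr_eq0 -lt0n.
pose v i j : R := (u i j)%:R / (s j)%:R.
have v0 i j : 0 <= v i j by apply: divr_ge0.
pose w i : R := (\sum_(j in P) v i j) / k%:R.
have w0 i : 0 <= w i by apply: divr_ge0 => //; apply: sumr_ge0.
have mw i : (m i)%:R <= p * w i.
  rewrite -(@ler_pXn2r _ k)// ?nnegrE ?(mulr_ge0 (powR_ge0 _ _) (w0 _))//.
  rewrite exprMn pS.
  apply: (@le_trans _ _ (\prod_j (u i j)%:R)).
    by rewrite -natrX -natr_prod ler_nat mu.
  rewrite [leLHS](_ : _ = S * \prod_j v i j); last first.
    rewrite -big_split/=; apply: eq_bigr => j _.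
    by rewrite /v mulrCA divff ?mulr1// gt_eqF.
  rewrite ler_wpM2l// (bigID (mem P))/=.
  apply: (@le_trans _ _ ((\prod_(j in P) v i j) * 1)).
    rewrite ler_wpM2l ?prodr_ge0//; apply: prodr_ile1 => j jP; rewrite v0/=.
    by rewrite ler_pdivrMr// mul1r ler_nat.
  by rewrite mulr1 /w -Pk; apply: (leif_AGM (A := P)) => j _.
rewrite -(ler_nat R) natrX natr_sum natr_prod -/S -pS.
have sumw : \sum_i w i <= 1.
  rewrite -big_distrl/= ler_pdivrMr ?ltr0n// mul1r exchange_big/=.
  apply: (@le_trans _ _ (\sum_(j in P) 1)).
    apply: ler_sum => j jP; rewrite -big_distrl/= ler_pdivrMr// mul1r.
    by rewrite -natr_sum ler_nat us.
  by rewrite sumr_const Pk.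
apply: lerXn2r; rewrite ?nnegrE ?powR_ge0//; first by apply: sumr_ge0.
apply: le_trans (ler_sum _ (fun i _ => mw i)) _.
by rewrite -big_distrr/= ler_piMr// powR_ge0.
Qed.

Section Shearer.
Variables (R : realType) (G : groupType) (A : finType).
Implicit Types (X : set (config G A)) (O L : {fset G}).

Lemma nval_pattern_le X O : (nval X (pattern O) <= #|A| ^ #|` O|)%N.
Proof.
by apply: leq_trans (nval_le_card _ _) _; rewrite card_ffun cardfE.
Qed.

(** Induction on [O]: remove a site [w] and split [X] by the letter at [w]. For the [k] indices with
    [w] in [L j] the classes have disjoint pattern sets, so their counts add up; for the others each
    class inherits the bound for [X]. [holder_nat] combines both. *)
Lemma shearer (J : finType) (L : J -> {fset G}) k O X : (0 < k)%N ->
  (forall o, o \in O -> #|[pred j | o \in L j]| = k) ->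
  (nval X (pattern O) ^ k <= \prod_j nval X (pattern (L j)))%N.
Proof.
move=> k0; elim/finSet_rect: O X => O IH X kO.
have [eO|[w wO]] := fset_0Vmem O.
  have [X0|X0] := EM (X !=set0).
    apply: (@leq_trans (1 ^ k)); last first.
      by rewrite exp1n; apply: prodn_gt0 => j; exact/nval_gt0.
    rewrite leq_exp2r//; apply: leq_trans (nval_pattern_le X O) _.
    by rewrite eO cardfs0 expn0.
  have -> : nval X (pattern O) = 0%N; last by rewrite exp0n.
  by apply/eqP; rewrite -leqn0 leqNgt; apply/negP => /nval_gt0.
pose Xa a := X `&` [set x : config G A | x w = a].
pose P := [pred j | w \in L j].
apply: (@leq_trans ((\sum_a nval (Xa a) (pattern O)) ^ k)).
  by rewrite leq_exp2r//; exact: leq_nval_fiber.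
apply: (@holder_nat R A J k _ (fun a j => nval (Xa a) (pattern (L j))) _ P) => //.
- exact: kO.
- move=> a; apply: (@leq_trans (nval (Xa a) (pattern (O `\ w)%fset) ^ k)).
    rewrite leq_exp2r//; apply: leq_nval_fun => x y [Xx xw] [Xy yw] /patternP xy.
    apply/patternP => h hO; have [->|hw] := eqVneq h w; first by rewrite xw yw.
    by apply: xy; rewrite !inE hw.
  apply: IH; first by rewrite fproperD1.
  by move=> h; rewrite !inE => /andP[_ /kO].
- move=> j jP; rewrite /nval -[leqRHS]sum1_card.
  under eq_bigr do rewrite -sum1_card.
  rewrite (exchange_big_dep [pred b | `[<(pattern (L j) @` X) b>]])/=; last first.
    by move=> a b _ /nvalP[x [Xx xw] <-]; apply/nvalP; exists x.
  (* The pattern [b] shows the letter at [w], so it is counted for at most one letter. *)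
  apply: leq_sum => b _; rewrite sum1_card.
  apply/card_le1_eqP => a1 a2 /asboolP[x1 [_ x1w] x1b] /asboolP[x2 [_ x2w] x2b].
  rewrite -x1w -x2w; apply: (proj1 (patternP (L j) _ _)) => //.
  by rewrite x2b x1b.
- by move=> a j _; apply: leq_nval_sub => x [].
Qed.

End Shearer.

(** * Finite sets in groups and Følner sequences *)

Lemma mem_sep_fset (T : choiceType) (U : {fset T}) (Q : pred T) u :
  (u \in [fset u in U | Q u]%fset) = (u \in U) && Q u.
Proof. by rewrite !inE. Qed.

Section FsetMul.
Variable G : groupType.
Implicit Types (U V E N : {fset G}).

Definition fmul U V : {fset G} := [fset (x * y)%g | x in U, y in V]%fset.
Definition finv V : {fset G} := [fset x^-1%g | x in V]%fset.
Definition lmul g V : {fset G} := [fset (g * y)%g | y in V]%fset.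

Lemma fmulP U V g :
  reflect (exists2 u, u \in U & exists2 v, v \in V & g = (u * v)%g)
    (g \in fmul U V).
Proof.
apply: (iffP (imfset2P _ _ _ _ _)) => /= -[u uU [v vV ->]].
  by exists u => //; exists v.
by exists u => //; exists v.
Qed.

Lemma mem_fmul U V u v : u \in U -> v \in V -> (u * v)%g \in fmul U V.
Proof. by move=> uU vV; apply/fmulP; exists u => //; exists v. Qed.

Lemma mem_finv V v : (v \in finv V) = (v^-1%g \in V).
Proof.
apply/imfsetP/idP => /= [[x xV ->]|vV]; first by rewrite invgK.
by exists v^-1%g; rewrite ?invgK.
Qed.

Lemma mem_lmul g V h : (h \in lmul g V) = ((g^-1 * h)%g \in V).
Proof.
apply/imfsetP/idP => /= [[x xV ->]|hV]; first by rewrite mulKg.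
by exists (g^-1 * h)%g; rewrite ?mulVKg.
Qed.

Lemma card_lmul g V : #|` lmul g V| = #|` V|.
Proof. by rewrite card_imfset//=; exact: mulgI. Qed.

Lemma card_finv V : #|` finv V| = #|` V|.
Proof. by rewrite card_imfset//=; exact: invg_inj. Qed.

Lemma card_fmul U V : (#|` fmul U V| <= #|` U| * #|` V|)%N.
Proof.
rewrite -[leqRHS](size_allpairs (fun x y => (x * y)%g)).
apply: leq_trans (size_undup _); rewrite -card_fseq.
apply: fsubset_leq_card; apply/fsubsetP => g /fmulP[u uU [v vV ->]].
by rewrite inE /=; apply/allpairsP; exists (u, v).
Qed.

Lemma fmulA U V N : fmul (fmul U V) N = fmul U (fmul V N).
Proof.
apply/fsetP => g; apply/fmulP/fmulP.
  move=> [_ /fmulP[u uU [v vV ->]] [n nN ->]]; exists u => //.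
  by exists (v * n)%g; rewrite ?mem_fmul ?mulgA.
move=> [u uU [_ /fmulP[v vV [n nN ->]] ->]]; exists (u * v)%g; rewrite ?mem_fmul//.
by exists n; rewrite ?mulgA.
Qed.

Definition core N U : {fset G} :=
  [fset h in U | (lmul h N `<=` U)%fset]%fset.

Lemma coreP N U h :
  reflect (h \in U /\ forall n, n \in N -> (h * n)%g \in U) (h \in core N U).
Proof.
rewrite !inE/=; apply: (iffP andP) => -[hU hN]; split=> //.
  by move=> n nN; apply: (fsubsetP hN); rewrite mem_lmul mulKg.
by apply/fsubsetP => u; rewrite mem_lmul => /hN; rewrite mulVKg.
Qed.

End FsetMul.

Section Folner.
Variables (R : realType) (G : groupType) (S : {fset G}).
Hypothesis genS : generates S.

Lemma finite_words n : finite_set [set g : G | is_word S n g].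
Proof.
elim: n => [|n IH].
  apply: (@sub_finite_set _ _ [set 1%g]) => // g [s [/size0nil -> _]].
  by rewrite big_nil => <-.
pose T := [set x : G | (x \in S) || (x^-1%g \in S)].
have finT : finite_set T.
  apply: (@sub_finite_set _ _ [set` (S `|` finv S)%fset]); last exact: finite_fset.
  by move=> x; rewrite /T/= inE mem_finv.
apply: (@sub_finite_set _ _ ((fun p => p.1 * p.2)%g @` (T `*` [set g : G | is_word S n g]))).
  move=> g [[|x s] []//= [ss] /andP[xT sT]]; rewrite big_cons => <-.
  by exists (x, (\prod_(x <- s) x)%g) => //; split=> //; exists s.
exact/finite_image/finite_setX.
Qed.

Lemma finite_ball r : finite_set (ball_at1 S r).
Proof.
apply: (@sub_finite_set _ _ (\bigcup_(n in `I_r.+1) [set g : G | is_word S n g])).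
  move=> g; rewrite /ball_at1/= /word_dist invg1 mul1g /word_length.
  case: pselect => [e|[]].
    by case: ex_minnP => m /asboolP wm _ mr; exists m.
  by have [n ng] := genS g; exists n; apply/asboolP.
by apply: bigcup_finite => // n _; exact: finite_words.
Qed.

Lemma finite_boundary r (F : {fset G}) : finite_set (boundary S r F).
Proof.
apply: (@sub_finite_set _ _
   ((fun p => p.1 * p.2^-1)%g @` ([set` F] `*` ball_at1 S r))).
  move=> g [[_ [[b br <-] gbF]] _].
  by exists ((g * b)%g, b) => //=; rewrite mulgK.
by apply: finite_image; apply: finite_setX; [exact: finite_fset|exact: finite_ball].
Qed.

Lemma fset_sub_ball (N : {fset G}) :
  exists r, forall g, g \in N -> ball_at1 S r g.
Proof.
exists (\max_(g <- N) word_length S g) => g gN.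
rewrite /ball_at1/= /word_dist invg1 mul1g.
by rewrite (big_rem g)//= leq_maxl.
Qed.

Variable F : nat -> {fset G}.
Hypothesis folF : folner S R F.

(** If [N] lies in the ball of radius [r], then [D] lies in the [r]-boundary of [F n]. Quantifying
    over [D] after [n] lets one [n] serve all such sets. *)
Lemma folner_boundary (N : {fset G}) (d : R) : 0 < d ->
  \forall n \near \oo, forall D : {fset G},
    (forall h, h \in D -> (exists2 k, k \in N & (h * k)%g \in F n) /\
                          (exists2 k, k \in N & (h * k)%g \notin F n)) ->
    #|` D|%:R <= d * #|` F n|%:R.
Proof.
move=> d0; have [r Nr] := fset_sub_ball N.
have [F0 /(_ r)/cvgr_lt/(_ d d0)] := folF.
apply: filterS => n rhod D DP.
rewrite -ler_pdivrMr; last by rewrite ltr0n cardfs_gt0 F0.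
apply: le_trans (ltW rhod); rewrite /rho ler_pM2r; last first.
  by rewrite invr_gt0 ltr0n cardfs_gt0 F0.
rewrite ler_nat; apply: fsubset_leq_card; apply/fsubsetP => h /DP[[k kN hk] [l lN hl]].
rewrite in_fset_set; last exact: finite_boundary.
rewrite inE; split.
  by exists (h * k)%g; split => //; exists k => //; exact: Nr.
by exists (h * l)%g; split; [exists l => //; exact: Nr|exact/negP].
Qed.

Lemma folner_fmul (N : {fset G}) (d : R) : 0 < d ->
  \forall n \near \oo, #|` fmul (F n) N|%:R <= (1 + d) * #|` F n|%:R.
Proof.
move=> d0; apply: filterS (folner_boundary (1%g |` finv N)%fset d0) => n Hn.
rewrite mulrDl mul1r; apply: (@le_trans _ _ (#|` F n|%:R + #|` (fmul (F n) N `\` F n)%fset|%:R)).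
  rewrite -natrD ler_nat -[leqLHS](cardfsID (F n)) leq_add2r.
  by apply: fsubset_leq_card; exact: fsubsetIr.
rewrite lerD2l; apply: Hn => h; rewrite inE => /andP[hF /fmulP[u uF [v vN hE]]].
split; last by exists 1%g; rewrite ?mulg1// !inE eqxx.
by exists v^-1%g; rewrite ?hE ?mulgK// inE mem_finv invgK vN orbT.
Qed.

Lemma folner_core (N : {fset G}) (d : R) : 0 < d ->
  \forall n \near \oo, #|` (F n `\` core N (F n))%fset|%:R <= d * #|` F n|%:R.
Proof.
move=> d0; apply: filterS (folner_boundary (1%g |` N)%fset d0) => n Hn.
apply: Hn => h; rewrite inE => /andP[/coreP hc hF].
split; first by exists 1%g; rewrite ?mulg1// !inE eqxx.
apply: contrapT => nk; apply: hc; split=> // k kN; apply: contrapT => /negP hk.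
by apply: nk; exists k => //; rewrite inE kN orbT.
Qed.

Hypothesis infG : infinite_set [set: G].

(** As soon as the core for a large set [N] is nonempty, [F n] contains a translate of [N]. *)
Lemma folner_card (m : nat) : \forall n \near \oo, (m <= #|` F n|)%N.
Proof.
have [N _ Nm] := infinite_set_fset m infG.
have F0 := proj1 folF.
apply: filterS (folner_core N (_ : 0 < 2^-1)) => // n Hn.
apply: (leq_trans Nm).
have [c0|[h /coreP[_ hN]]] := fset_0Vmem (core N (F n)).
  have Fn0 : (0 : R) < #|` F n|%:R by rewrite ltr0n cardfs_gt0.
  by move: Hn; rewrite c0 fsetD0; lra.
rewrite -(card_lmul h); apply: fsubset_leq_card; apply/fsubsetP => g.
by rewrite mem_lmul => /hN; rewrite mulVKg.
Qed.

End Folner.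

(** * Entropy as an infimum *)

Definition shift_invariant_set (G : groupType) (A : finType) (X : set (config G A)) :=
  forall g x, X x -> X (translate g x).

Section Entropy.
Variables (R : realType) (G : groupType).
Implicit Types (A B C : finType) (E U N : {fset G}).

Definition npat A (X : set (config G A)) E : nat := nval X (pattern E).

(** For nonempty shifts this is the entropy ([entropyE]). It makes sense for any set of
    configurations, and a single finite set yields an upper bound. *)
Definition ent A (X : set (config G A)) : R :=
  inf [set ln (npat X E)%:R / #|` E|%:R | E in [set E : {fset G} | E != fset0]].

Lemma npat_gt0 A (X : set (config G A)) E : X !=set0 -> (0 < npat X E)%N.
Proof. by move=> X0; exact/nval_gt0. Qed.

Lemma npat_lmul A (X : set (config G A)) g E : shift_invariant_set X ->
  (npat X (lmul g E) <= npat X E)%N.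
Proof.
move=> iX; apply: (@leq_trans (nval X (pattern E \o translate g^-1%g))).
  apply: leq_nval_fun => x y _ _ /patternP xy; apply/patternP => h.
  by rewrite mem_lmul => /xy; rewrite /translate invgK mulVKg.
rewrite -nval_image; apply: leq_nval_sub => _ [x Xx <-]; exact: iX.
Qed.

(** The translates of [E] through [w] are those by [w * e^-1], one for each [e] in [E]; this is the
    uniform covering of [U] that [shearer] requires. *)
Lemma card_translates E U w : w \in U ->
  #|[pred u : fmul U (finv E) | w \in lmul (val u) E]| = #|` E|.
Proof.
move=> wU; rewrite cardfE.
have inJ (e : E) : (w * (val e)^-1)%g \in fmul U (finv E).
  by apply: mem_fmul => //; rewrite mem_finv invgK; exact: valP.
pose h (e : E) : fmul U (finv E) := [` inJ e]%fset.
have hinj : injective h.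
  by move=> e e' /(congr1 val)/= /mulgI/invg_inj/val_inj.
rewrite -(card_codom hinj); apply: eq_card => j; rewrite !inE mem_lmul.
apply/idP/codomP => [jE|[e ->]].
  exists [` jE]%fset; apply: val_inj => /=.
  by rewrite invgM invgK mulVKg.
by rewrite /= invgM invgK -mulgA mulVg mulg1; exact: valP.
Qed.

Lemma npat_shearer A (X : set (config G A)) E U : shift_invariant_set X ->
  E != fset0 -> (npat X U ^ #|` E| <= npat X E ^ #|` fmul U (finv E)|)%N.
Proof.
move=> iX E0; pose J := fmul U (finv E).
apply: leq_trans (@shearer R G A J (fun j => lmul (val j) E) #|` E| U X _ _) _.
- by rewrite cardfs_gt0.
- by move=> w wU; exact: card_translates.
- apply: (@leq_trans (\prod_(j : J) npat X E)).
    by apply: leq_prod => j _; exact: npat_lmul.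
  by rewrite prod_nat_const -cardfE.
Qed.

Lemma ln_natr_ge0 n : 0 <= ln (n%:R : R).
Proof.
case: n => [|n]; first by rewrite ln0.
by rewrite ln_ge0// ler1n.
Qed.

Lemma ler_ln_nat m n : (0 < m)%N -> (m <= n)%N -> ln (m%:R : R) <= ln n%:R.
Proof.
by move=> m0 mn; rewrite ler_ln ?posrE ?ltr0n// ?(leq_trans m0)// ler_nat.
Qed.

Lemma ln_npat_shearer A (X : set (config G A)) E U : shift_invariant_set X ->
  X !=set0 -> E != fset0 ->
  #|` E|%:R * ln (npat X U)%:R <= #|` fmul U (finv E)|%:R * ln (npat X E)%:R :> R.
Proof.
move=> iX X0 E0.
rewrite !mulr_natl -!lnXn ?ltr0n ?npat_gt0// -!natrX.
by apply: ler_ln_nat; rewrite ?expn_gt0 ?npat_gt0// npat_shearer.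
Qed.

Section Infimum.
Variables (A : finType) (X : set (config G A)).

Let entset_lb : lbound
  [set ln (npat X E)%:R / #|` E|%:R | E in [set E : {fset G} | E != fset0]] (0 : R).
Proof. by move=> _ [E _ <-]; rewrite divr_ge0 ?ln_natr_ge0. Qed.

Let entset_neq0 :
  [set (ln (npat X E)%:R / #|` E|%:R : R) | E in [set E : {fset G} | E != fset0]] !=set0.
Proof.
exists (ln (npat X [fset 1%g]%fset)%:R / #|` [fset 1%g : G]%fset|%:R).
by exists [fset 1%g]%fset => //=; rewrite -cardfs_gt0 cardfs1.
Qed.

Lemma ent_le E : E != fset0 -> ent X <= ln (npat X E)%:R / #|` E|%:R.
Proof. by move=> E0; apply: ge_inf; [exists 0|exists E]. Qed.

Lemma ent_ge c : (forall E, E != fset0 -> c <= ln (npat X E)%:R / #|` E|%:R) ->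
  c <= ent X.
Proof.
move=> cE; apply: lb_le_inf; first exact: entset_neq0.
by move=> _ [E E0 <-]; exact: cE.
Qed.

Lemma ent_lt c : ent X < c ->
  exists2 E, E != fset0 & ln (npat X E)%:R / #|` E|%:R < c.
Proof. by case/(inf_lt entset_neq0) => _ [E E0 <-]; exists E. Qed.

End Infimum.

Variable S : {fset G}.
Hypothesis genS : generates S.

Section Limit.
Variable F : nat -> {fset G}.
Hypothesis folF : folner S R F.

(** Only the upper bound needs work: take [E] nearly optimal in the infimum and apply Shearer's
    inequality to [F n], as [fmul (F n) (finv E)] is barely larger than [F n]. *)
Lemma ent_cvg A (X : set (config G A)) : shift_invariant_set X -> X !=set0 ->
  ln (npat X (F n))%:R / #|` F n|%:R @[n --> \oo] --> ent X.
Proof.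
move=> iX X0; have F0 := proj1 folF; apply/cvgrPdist_le => e e0.
have [E E0 Ee] : exists2 E, E != fset0 & ln (npat X E)%:R / #|` E|%:R < ent X + e / 2.
  by apply: ent_lt => //; rewrite ltrDl divr_gt0.
set a := ln (npat X E)%:R / _ in Ee.
have a0 : 0 <= a by rewrite divr_ge0 ?ln_natr_ge0.
have d0 : 0 < e / 2 / (a + 1) by rewrite !divr_gt0// ltr_pwDr.
apply: filterS (folner_fmul genS folF (finv E) d0) => n Hn.
have Fn0 : 0 < #|` F n|%:R :> R by rewrite ltr0n cardfs_gt0.
have E0' : 0 < #|` E|%:R :> R by rewrite ltr0n cardfs_gt0.
rewrite distrC ger0_norm ?subr_ge0 ?ent_le// lerBlDr.
have := ln_npat_shearer (F n) iX X0 E0; set b := ln _ => bE.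
rewrite ler_pdivrMr//.
have ba : b <= #|` fmul (F n) (finv E)|%:R * a.
  by rewrite /a mulrA ler_pdivlMr// mulrC.
apply: (le_trans ba); apply: (le_trans (ler_wpM2r a0 Hn)).
rewrite mulrAC ler_pM2r// mulrDl mul1r.
have : e / 2 / (a + 1) * a <= e / 2.
  rewrite -mulrA -[leRHS]mulr1 ler_pM2l ?divr_gt0//.
  by rewrite mulrC ler_pdivrMr ?mul1r ?lerDl// ltr_pwDr.
by move: Ee; lra.
Qed.

End Limit.

Hypothesis amG : amenable S R.

Lemma ent_leD A B C (X : set (config G A)) (Y : set (config G B)) (Z : set (config G C)) :
  shift_invariant_set X -> shift_invariant_set Y -> shift_invariant_set Z ->
  X !=set0 -> Y !=set0 -> Z !=set0 ->
  (forall E, npat X E <= npat Y E * npat Z E)%N -> ent X <= ent Y + ent Z.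
Proof.
move=> iX iY iZ X0 Y0 Z0 XYZ; have [F folF] := amG.
apply: (@ler_cvg_to _ _ _ _ _ _ _ _ (ent_cvg folF iX X0) (cvgD (ent_cvg folF iY Y0) (ent_cvg folF iZ Z0))).
apply: nearW => n; rewrite -[leRHS]/(_ / _ + _ / _) -mulrDl ler_pM2r; last first.
  by rewrite invr_gt0 ltr0n cardfs_gt0 (proj1 folF).
rewrite -lnM ?posrE ?ltr0n ?npat_gt0// -natrM.
by apply: ler_ln_nat; rewrite ?npat_gt0.
Qed.

(** The pattern hypothesis holds for images under a block code with window [N]. Replacing [F n] by
    [fmul (F n) N] costs nothing in the limit. *)
Lemma ent_le_code A B (X : set (config G A)) (Y : set (config G B)) N :
  shift_invariant_set X -> X !=set0 -> Y !=set0 ->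
  (forall E, npat Y E <= npat X (fmul E N))%N -> ent Y <= ent X.
Proof.
move=> iX X0 Y0 YX; have [F folF] := amG; have F0 := proj1 folF.
apply: ent_ge => // E E0; apply/ler_addgt0Pr => e e0.
set a := ln (npat X E)%:R / _.
have a0 : 0 <= a by rewrite divr_ge0 ?ln_natr_ge0.
have d0 : 0 < e / (a + 1) by rewrite !divr_gt0// ltr_pwDr.
have [n Hn] := filter_ex (folner_fmul genS folF (fmul N (finv E)) d0).
have Fn0 : 0 < #|` F n|%:R :> R by rewrite ltr0n cardfs_gt0.
have E0' : 0 < #|` E|%:R :> R by rewrite ltr0n cardfs_gt0.
apply: (le_trans (ent_le Y (F0 n))); rewrite ler_pdivrMr//.
apply: le_trans (ler_ln_nat (npat_gt0 _ Y0) (YX (F n))) _.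
have := ln_npat_shearer (fmul (F n) N) iX X0 E0; set b := ln _ => bE.
have ba : b <= #|` fmul (fmul (F n) N) (finv E)|%:R * a.
  by rewrite /a mulrA ler_pdivlMr// mulrC.
rewrite fmulA in ba.
apply: (le_trans ba); apply: (le_trans (ler_wpM2r a0 Hn)).
rewrite mulrAC ler_pM2r// mulrDl mul1r lerD2l.
rewrite -mulrA -[leRHS]mulr1 ler_pM2l//.
by rewrite mulrC ler_pdivrMr ?mul1r ?lerDl// ltr_pwDr.
Qed.

Lemma npat_fset_set A (X : subshift G A) E :
  #|` fset_set (patterns E X)| = npat X E.
Proof.
rewrite /npat /nval cardE; apply/perm_size/uniq_perm; rewrite ?fset_uniq ?enum_uniq//.
move=> b; rewrite mem_enum in_fset_set; last exact: finite_finset.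
by apply/idP/idP => [/set_mem|] bX; [apply/nvalP|apply/mem_set/nvalP].
Qed.

Lemma entropy_unique A (X : subshift G A) (h : \bar R) :
  (forall F, folner S R F -> pattern_entropy R (F n) X @[n --> \oo] --> h) ->
  entropy R S X = h.
Proof.
move=> hP; apply: xget_unique => [//|h' h'P]; have [F folF] := amG.
exact: (cvg_unique (@ereal_hausdorff R) (h'P F folF) (hP F folF)).
Qed.

Lemma entropyE A (X : subshift G A) :
  shift_set X !=set0 -> entropy R S X = (ent X)%:E.
Proof.
move=> X0; apply: entropy_unique => F folF.
have -> : (fun n => pattern_entropy R (F n) X) =
    EFin \o (fun n => ln (npat X (F n))%:R / #|` F n|%:R).
  apply/funext => n; rewrite /pattern_entropy npat_fset_set lne_EFin ?ltr0n ?npat_gt0//.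
  by rewrite -EFinM mulrC.
apply: cvg_EFin; first exact: nearW.
exact: (ent_cvg folF (@shift_invariant _ _ X) X0).
Qed.

(** This value excludes the empty shift from every [shifts_ge]. *)
Lemma entropy0 A (X : subshift G A) : ~ (shift_set X !=set0) -> entropy R S X = -oo%E.
Proof.
move=> X0; apply: entropy_unique => F [F0 _].
have -> : (fun n => pattern_entropy R (F n) X) = fun=> -oo%E; last exact: cvg_cst.
apply/funext => n; rewrite /pattern_entropy npat_fset_set.
have -> : npat X (F n) = 0%N.
  by apply/eqP; rewrite -leqn0 leqNgt; apply/negP => /nval_gt0.
by rewrite le0_lneNy ?lexx// gt0_muleNy ?lte_fin ?invr_gt0 ?ltr0n ?cardfs_gt0.
Qed.

End Entropy.

(** * Block codes *)

Section BlockCodes.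
Variable G : groupType.
Implicit Types (A B C : finType) (N : {fset G}).

(* A single condition expressing both that the value at [g] only depends on
   the window [g N] and that the dependence is the same at every [g]. *)
Definition block_code A B N (f : config G A -> config G B) :=
  forall x y g h, (forall n, n \in N -> x (g * n)%g = y (h * n)%g) ->
  f x g = f y h.

Lemma block_code_translate A B N (f : config G A -> config G B) g x :
  block_code N f -> f (translate g x) = translate g (f x).
Proof.
move=> fN; apply/funext => h; rewrite {2}/translate.
by apply: fN => n _; rewrite /translate mulgA.
Qed.

Lemma block_code_continuous A B N (f : config G A -> config G B) :
  block_code N f -> continuous f.
Proof.
move=> fN x U /nbhs_configP[K KU]; apply/nbhs_configP.
exists (fmul K N) => y xy; apply: KU => k kK; apply: fN => n nN.
by apply: xy; exact: mem_fmul.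
Qed.

Lemma block_code_comp A B C N M (f : config G A -> config G B)
    (f' : config G B -> config G C) :
  block_code N f -> block_code M f' -> block_code (fmul M N) (f' \o f).
Proof.
move=> fN fM x y g h xy; apply: fM => m mM; apply: fN => n nN.
by rewrite -!mulgA; apply: xy; exact: mem_fmul.
Qed.

Lemma compact_config A : compact [set: config G A].
Proof.
have := @tychonoff G (fun=> discrete_topology A) (fun=> setT) _.
rewrite (_ : [set f | _] = setT); last by apply/seteqP.
by apply => _; apply: finite_compact; exact: finite_finset.
Qed.

Lemma hausdorff_config A : hausdorff_space (config G A).
Proof. by apply: hausdorff_product => g; exact: discrete_hausdorff. Qed.

Lemma compact_subshift A (X : subshift G A) : compact (shift_set X).
Proof.
by apply: subclosed_compact (@compact_config A) _ => //; exact: shift_closed.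
Qed.

Section Image.
Variables (A B : finType) (N : {fset G}) (f : config G A -> config G B).
Hypothesis fN : block_code N f.
Variable X : subshift G A.

Lemma code_image_closed : closed (f @` X).
Proof.
apply: compact_closed; first exact: hausdorff_config.
apply: continuous_compact; last exact: compact_subshift.
by apply: continuous_subspaceT; exact: block_code_continuous fN.
Qed.

Lemma code_image_invariant : shift_invariant_set (f @` X).
Proof.
move=> g _ [x Xx <-]; exists (translate g x); first exact: shift_invariant.
exact: block_code_translate fN.
Qed.

Definition code_image : subshift G B := Shift code_image_closed code_image_invariant.

Lemma code_image_factor : is_factor X code_image.
Proof.
exists (f \o set_val); split.
- move=> x; apply: continuous_comp; first exact: initial_continuous.
  exact: block_code_continuous fN _.
- by move=> g x y xy /=; rewrite xy; exact: block_code_translate fN.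
- apply/seteqP; split=> [_ [x _ <-]|_ [x Xx <-]] /=.
    by exists (set_val x) => //; exact: set_valP.
  by exists (SigSub (mem_set Xx)).
Qed.

End Image.

End BlockCodes.

(** * Low-entropy colourings *)

Lemma le_bound_norm (R : realType) (x : R) : x <= (Num.bound `|x|)%:R.
Proof. exact: le_trans (ler_norm x) (ltW (archi_boundP (normr_ge0 x))). Qed.

(** Since [ln (d * v) <= d * v], one has [ln v <= d * v - ln d]. The slope [d] is such that [k.+1]
    copies use half of [e * v]; the constants fit into the other half for large [v]. *)
Lemma ln_poly_small (R : realType) (a k : nat) (e : R) : 0 < e ->
  exists v0 : nat, forall v, (v0 <= v)%N -> ln (a * v ^ k)%:R <= e * v%:R.
Proof.
move=> e0; pose d := e / 2 / k.+1%:R.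
have d0 : 0 < d by rewrite !divr_gt0.
pose c : R := ln a.+1%:R - k.+1%:R * ln d.
exists (maxn 1 (Num.bound `|2 * c / e|)) => v; rewrite geq_max => /andP[v0 vc].
have v0' : (0 : R) < v%:R by rewrite ltr0n.
have lnv : ln (v%:R : R) <= d * v%:R - ln d.
  have : ln (d * v%:R) <= d * v%:R by apply/ltW/ln_sublinear; rewrite mulr_gt0.
  by rewrite lnM ?posrE// => ?; lra.
have lnv0 : 0 <= ln (v%:R : R) by exact: ln_natr_ge0.
have cv : c <= e / 2 * v%:R.
  have : 2 * c / e <= v%:R.
    by apply: le_trans (le_bound_norm _) _; rewrite ler_nat.
  by rewrite ler_pdivrMr// => ?; lra.
apply: (@le_trans _ _ (ln (a.+1 * v ^ k.+1)%:R)).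
  have [->|a0] := posnP a; first by rewrite mul0n ln0 ?ln_natr_ge0.
  apply: ler_ln_nat; first by rewrite muln_gt0 a0 expn_gt0 v0.
  by apply: leq_mul => //; apply: leq_pexp2l.
rewrite natrM natrX lnM ?posrE ?exprn_gt0// lnXn// -[ln _ *+ _]mulr_natl.
have : k.+1%:R * ln v%:R <= k.+1%:R * (d * v%:R - ln d) :> R by rewrite ler_pM2l.
have : k.+1%:R * (d * v%:R) = e / 2 * v%:R.
  by rewrite mulrA /d [_ * (_ / _)]mulrC divfK// pnatr_eq0.
by rewrite mulrBr; move: cv; rewrite /c => ? ? ?; lra.
Qed.

Section Coloring.
Variables (R : realType) (G : groupType) (S : {fset G}).
Hypotheses (genS : generates S) (amG : amenable S R).

Section ColoredNet.
(* A maximal [Q]-separated set whose points are coloured, distinct points related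
   by [W] having distinct colours; [z g = None] when [g] is not in the set. *)
Variables (Q W : {fset G}) (M : nat).
Hypotheses (Q1 : 1%g \in Q) (QV : forall g, g \in Q -> g^-1%g \in Q).
Hypotheses (WV : forall g, g \in W -> g^-1%g \in W) (WM : (#|` W| < M)%N).

Let B : finType := option 'I_M.

Definition colored_net : set (config G B) := [set z |
  [/\ forall g h, z g != None -> z h != None -> (g^-1 * h)%g \in Q -> g = h,
      forall g h, z g != None -> z g = z h -> (g^-1 * h)%g \in W -> g = h &
      forall g, exists2 q, q \in Q & z (g * q)%g != None]].

Lemma colored_net_closed : closed colored_net.
Proof.
move=> z clz.
have zK (K : {fset G}) : exists2 w, colored_net w & {in K, z =1 w}.
  have [w [Zw zw]] : colored_net `&` [set w | {in K, z =1 w}] !=set0.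
    by apply: clz; apply/nbhs_configP; exists K.
  by exists w.
split.
- move=> g h; have [w [sw _ _] zw] := zK [fset g; h]%fset.
  by rewrite !zw ?inE ?eqxx ?orbT//; exact: sw.
- move=> g h; have [w [_ cw _] zw] := zK [fset g; h]%fset.
  by rewrite !zw ?inE ?eqxx ?orbT//; exact: cw.
- move=> g; have [w [_ _ mw] zw] := zK (lmul g Q).
  have [q qQ wq] := mw g; exists q => //.
  by rewrite zw// mem_lmul mulKg.
Qed.

Lemma colored_net_invariant : shift_invariant_set colored_net.
Proof.
move=> t z [sz cz mz]; rewrite /translate; split.
- move=> g h zg zh gh; apply: (mulgI t^-1%g); apply: sz => //.
  by rewrite invgM invgK -mulgA mulVKg.
- move=> g h zg zh gh; apply: (mulgI t^-1%g); apply: cz => //.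
  by rewrite invgM invgK -mulgA mulVKg.
- by move=> g; have [q qQ zq] := mz (t^-1 * g)%g; exists q; rewrite // mulgA.
Qed.

Definition net_shift : subshift G B := Shift colored_net_closed colored_net_invariant.

(** A partial coloured net is a set of pairs of a site and its colour; [valid] asks for everything
    in [colored_net] except the covering condition. *)
Let compat (p p' : G * 'I_M) := p = p' \/
  (p.1^-1 * p'.1)%g \notin Q /\ (p.2 = p'.2 -> (p.1^-1 * p'.1)%g \notin W).

Let valid (D : set (G * 'I_M)) := forall p p', D p -> D p' -> compat p p'.

Lemma compat_sym p p' : compat p p' -> compat p' p.
Proof.
case=> [->|[pQ pW]]; [by left|right].
have inv (X : {fset G}) : (forall g, g \in X -> g^-1%g \in X) ->
    (p.1^-1 * p'.1)%g \notin X -> (p'.1^-1 * p.1)%g \notin X.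
  by move=> XV; apply: contra => /XV; rewrite invgM invgK.
by split=> [|/esym/pW]; exact: inv.
Qed.

Lemma colored_net_extend (D0 : set (G * 'I_M)) : valid D0 ->
  exists2 z, colored_net z & forall g i, D0 (g, i) -> z g = Some i.
Proof.
move=> D0v; have [|D [DD0v Dmax]] := @Zorn_bigcup _ [set D | valid (D `|` D0)].
  move=> C CP Ctot p p' [[X CX Xp]|D0p] [[Y CY Yp']|D0p'].
  - have [XY|YX] := Ctot _ _ CX CY.
      by apply: (CP _ CY); left => //; exact: XY.
    by apply: (CP _ CX); left => //; exact: YX.
  - by apply: (CP _ CX); [left|right].
  - by apply: (CP _ CY); [right|left].
  - exact: D0v.
pose E := D `|` D0; have Ev : valid E := DD0v.
pose z : config G B := fun g => [pick i | `[< E (g, i) >]].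
have zP g i : z g = Some i <-> E (g, i).
  rewrite /z; case: pickP => [j /asboolP Ej|nE]; last first.
    by split=> // /asboolP; rewrite nE.
  split=> [[<-//]|Ei]; congr Some.
  have [[//]|[/=]] := Ev _ _ Ej Ei.
  by rewrite mulVg Q1.
have zN g : z g != None -> exists2 i, z g = Some i & E (g, i).
  by case zg: (z g) => [i|]// _; exists i => //; exact/zP.
exists z; last by move=> g i D0gi; apply/zP; right.
split.
- move=> g h /zN[i _ Ei] /zN[j _ Ej] gh.
  by have [[]//|[/=]] := Ev _ _ Ei Ej; rewrite gh.
- move=> g h /zN[i zg Ei] zgh gh; have : z h != None by rewrite -zgh zg.
  move=> /zN[j zh Ej]; have [[]//|[/= _]] := Ev _ _ Ei Ej.
  by move: zgh; rewrite zg zh => -[->] /(_ erefl); rewrite gh.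
move=> g; apply: contrapT => ng.
have gQ h : z h != None -> (g^-1 * h)%g \notin Q.
  by move=> zh; apply/negP => ghQ; apply: ng; exists (g^-1 * h)%g; rewrite // mulVKg.
pose used := pmap (fun w => z (g * w)%g) W.
have [i iused] : exists i, i \notin used.
  apply: contrapT => all_used.
  have : (#|'I_M| <= size used)%N.
    rewrite cardT; apply: uniq_leq_size; first exact: enum_uniq.
    by move=> i _; apply: contrapT => /negP iu; apply: all_used; exists i.
  rewrite card_ord size_pmap; apply/negP; rewrite -ltnNge.
  exact: leq_ltn_trans (count_size _ _) WM.
have newc p : E p -> compat (g, i) p.
  case: p => h j /zP zh; right; split=> /=; first by rewrite gQ// zh.
  move=> ij; apply/negP => ghW; move/negP: iused; apply.
  by rewrite mem_pmap; apply/mapP; exists (g^-1 * h)%g; rewrite // mulVKg zh ij.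
apply: (Dmax (D `|` [set (g, i)])).
  split; last by move=> /(_ (g, i)) Di; apply: ng; exists 1%g; rewrite ?mulg1//;
    have /zP -> : E (g, i) by left; apply: Di; right.
  by left.
have inE p : ((D `|` [set (g, i)]) `|` D0) p -> E p \/ p = (g, i).
  by move=> [[|]|]; [left; left|right|left; right].
move=> p p' /inE[Ep|->] /inE[Ep'|->]; [exact: Ev|exact/compat_sym/newc|exact: newc|by left].
Qed.

Lemma colored_net_neq0 : colored_net !=set0.
Proof. by have [|z zP _] := @colored_net_extend set0; [move=> []|exists z]. Qed.

(** When [K] and [H] are far apart, the points of [x] near [K] and those of [y] near [H] form a
    valid set, which [colored_net_extend] completes. *)
Lemma net_shift_irreducible : strongly_irreducible S net_shift.
Proof.
pose U := fmul Q (fmul (Q `|` W)%fset Q).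
pose r := \max_(u <- U) word_length S u.
have Ur u : (r < word_length S u)%N -> u \notin U.
  by move=> ru; apply/negP => uU; move: ru; rewrite ltnNge /r (big_rem u)//= leq_maxl.
exists r => K H KH x y Zx Zy.
have KHU k h a b : k \in K -> h \in H -> a \in Q -> b \in Q ->
    ((k * a)^-1 * (h * b))%g \notin (Q `|` W)%fset.
  move=> kK hH aQ bQ; apply/negP => abQW; have /Ur/negP := KH k h kK hH; apply.
  have -> : (k^-1 * h = a * (((k * a)^-1 * (h * b)) * b^-1))%g.
    by rewrite invgM !mulgA mulgV mul1g mulgK.
  by apply: mem_fmul => //; apply: mem_fmul => //; exact: QV.
pose P (L : {fset G}) (w : config G B) : set (G * 'I_M) :=
  [set p | w p.1 = Some p.2 /\ p.1 \in fmul L Q].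
have Pv L w : colored_net w -> valid (P L w).
  move=> [sw cw _] [g i] [h j] [/= wg _] [/= wh _].
  have [gh|gh] := eqVneq g h; first by left; move: wg; rewrite gh wh => -[->].
  right; split; first by apply: contra_neqN gh; apply: sw; rewrite ?wg ?wh.
  by move=> /= ij; apply: contra_neqN gh; apply: cw; rewrite wg ?wh ?ij.
have KHc p p' : P K x p -> P H y p' -> compat p p'.
  move=> [_ /fmulP[k kK [a aQ pE]]] [_ /fmulP[h hH [b bQ p'E]]]; right.
  have := KHU k h a b kK hH aQ bQ; rewrite -pE -p'E inE negb_or.
  by move=> /andP[].
have [|z Zz zP] := @colored_net_extend (P K x `|` P H y).
  move=> p p' [Kp|Hp] [Kp'|Hp'].
  - exact: Pv Kp Kp'.
  - exact: KHc.
  - exact/compat_sym/KHc.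
  - exact: Pv Hp Hp'.
have agr L w : colored_net w -> (forall p, P L w p -> z p.1 = Some p.2) ->
    pattern L z = pattern L w.
  move=> [sw cw mw] Pz; apply/patternP => g gL.
  case wg : (w g) => [i|].
    apply: (Pz (g, i)); split => //=.
    by rewrite -[g]mulg1; exact: mem_fmul.
  have [q qQ] := mw g; case wgq : (w (g * q)%g) => [i|]// _.
  have zgq : z (g * q)%g = Some i.
    by apply: (Pz (_, i)); split => //=; exact: mem_fmul.
  (* Where [w] has no point at [g], a point of [w] in [g Q] was kept in [z], and separation forbids
     a point of [z] at [g]. *)
  have [sz _ _] := Zz; apply/eqP; apply: contraT => zg.
  have := sz g (g * q)%g zg; rewrite zgq mulKg => /(_ isT qQ) gq.
  by move: wgq; rewrite -gq wg.
exists z; split=> //; apply: agr => // -[g i] Pgi; apply: zP; by [left|right].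
Qed.

End ColoredNet.

(** Points of [V] differ by elements of [fmul (finv V) V], so a net has at most one point in [V],
    and its position and colour determine the pattern. *)
Lemma npat_colored_net (V W : {fset G}) M :
  (npat (@colored_net (fmul (finv V) V) W M) V <= (#|` V| * M).+1)%N.
Proof.
set X := @colored_net _ _ _.
apply: (@leq_trans (nval X (fun z => [pick p : V * 'I_M | z (val p.1) == Some p.2]))).
  apply: leq_nval_fun => z z' Xz Xz' zz'; apply/patternP => v vV.
  have val1 (w : config G (option 'I_M)) (p : V * 'I_M) h : X w -> h \in V ->
      w (val p.1) = Some p.2 -> w h = if h == val p.1 then Some p.2 else None.
    move=> [sw _ _] hV wp; case: eqVneq => [->//|hp].
    apply/eqP; apply: contraNT hp => wh; apply/eqP; apply: (sw h (val p.1)) => //; first by rewrite wp.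
    by apply: mem_fmul; [rewrite mem_finv invgK|exact: fsvalP].
  move: zz'; case: pickP => [p /eqP zp|zN]; case: pickP => [p' /eqP zp'|zN']// pp'.
    case: pp' => pp'; rewrite pp' in zp.
    by rewrite (val1 z p' v Xz vV zp) (val1 z' p' v Xz' vV zp').
  have none (w : config G (option 'I_M)) :
      (fun p : V * 'I_M => w (val p.1) == Some p.2) =1 xpred0 -> w v = None.
    by case wv: (w v) => [i|]// => /(_ ([` vV]%fset, i))/=; rewrite wv eqxx.
  by rewrite !none.
apply: leq_trans (nval_le_card _ _) _.
by rewrite card_option card_prod card_ord -cardfE.
Qed.

(** The net has polynomially many patterns on [V], so a large [V] gives small entropy. If sites
    related by [P] have equal colours, their net points have the same colour and are related by [W],
    hence coincide; so do the sites. *)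
Lemma low_entropy_coloring (P : {fset G}) (e : R) :
  infinite_set [set: G] -> 0 < e ->
  exists (B I : finType) (Z : subshift G B) (N : {fset G})
      (f : config G B -> config G I),
    [/\ strongly_irreducible S Z, shift_set Z !=set0, block_code N f,
        (forall z, shift_set Z z -> forall g h, (g^-1 * h)%g \in P ->
           f z g = f z h -> g = h) &
        ent R (f @` Z) <= e].
Proof.
move=> infG e0; pose P' := (P `|` finv P)%fset.
have P'V g : g \in P' -> g^-1%g \in P'.
  by rewrite !inE !mem_finv invgK orbC.
(* The degree is 5 because [W] grows like the fourth power of the size of [V], and the position of a
   net point in [V] adds one more factor. *)
have [v0 v0P] := ln_poly_small (#|` P'| + 3) 5 e0.
have [V _ Vv] := infinite_set_fset (maxn 1 v0) infG.
move: Vv; rewrite geq_max => /andP[V0 Vv].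
have [v vV] : exists v, v \in V by apply/fset0Pn; rewrite -cardfs_gt0.
pose Q := fmul (finv V) V; pose W := fmul Q (fmul P' Q); pose M := #|` W|.+1.
have Q1 : 1%g \in Q.
  by rewrite -(mulVg v); apply: mem_fmul => //; rewrite mem_finv invgK.
have QV g : g \in Q -> g^-1%g \in Q.
  move=> /fmulP[a aV [b bV ->]]; rewrite invgM; rewrite mem_finv in aV.
  by apply: mem_fmul => //; rewrite mem_finv invgK.
have WV g : g \in W -> g^-1%g \in W.
  move=> /fmulP[a aQ [_ /fmulP[p pP [b bQ ->]] ->]].
  rewrite !invgM -mulgA.
  by apply: mem_fmul; rewrite ?QV// mem_fmul ?P'V ?QV.
pose Z := @net_shift Q W M.
pose f (z : config G (option 'I_M)) : config G (option ('I_M * Q)) :=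
  fun h => [pick p : 'I_M * Q | z (h * val p.2)%g == Some p.1].
have Z0 : shift_set Z !=set0 by exact: colored_net_neq0.
have fN : block_code Q f.
  move=> x y g h xy; rewrite /f; apply: eq_pick => p /=.
  by rewrite xy//; exact: fsvalP.
exists (option 'I_M), (option ('I_M * Q)%type), Z, Q, f; split=> //.
- exact: net_shift_irreducible.
- move=> z [sz cz mz] g h gh; rewrite /f.
  have some k : [pick p : 'I_M * Q | z (k * val p.2)%g == Some p.1] != None.
    case: pickP => // nz; have [q qQ] := mz k; case zq: (z _) => [i|]// _.
    by have := nz (i, [` qQ]%fset); rewrite /= zq eqxx.
  have := some g; case: pickP => // p /eqP zg _.
  have := some h; case: pickP => // p' /eqP zh _ [pp'].
  apply: (mulIg (val p.2)); rewrite -pp' in zh.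
  apply: cz; rewrite ?zg ?zh// invgM -mulgA.
  apply: mem_fmul; first by apply: QV; exact: fsvalP.
  by rewrite mulgA mem_fmul ?inE ?gh//; exact: fsvalP.
- have fZ0 : f @` Z !=set0 by have [z Zz] := Z0; exists (f z); exists z.
  apply: (@le_trans _ _ (ent R Z)).
    apply: (ent_le_code genS amG (N := Q) (@shift_invariant _ _ Z) Z0 fZ0) => E.
    rewrite /npat nval_image; apply: leq_nval_fun => x y _ _ /patternP xy.
    by apply/patternP => g gE; apply: fN => q qQ; apply: xy; exact: mem_fmul.
  have V0' : (0 : R) < #|` V|%:R by rewrite ltr0n.
  apply: (le_trans (ent_le _ _ (E := V) _)); first by rewrite -cardfs_gt0.
  rewrite ler_pdivrMr//; apply: le_trans _ (v0P _ Vv).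
  apply: ler_ln_nat; first exact: npat_gt0.
  apply: leq_trans (npat_colored_net V W M) _.
  have Qle : (#|` Q| <= #|` V| ^ 2)%N.
    by apply: leq_trans (card_fmul _ _) _; rewrite card_finv mulnn.
  have Wle : (#|` W| <= #|` V| ^ 4 * #|` P'|)%N.
    apply: leq_trans (card_fmul _ _) _.
    rewrite (expnD #|` V| 2 2) -mulnA; apply: leq_mul => //.
    by apply: leq_trans (card_fmul _ _) _; rewrite mulnC; apply: leq_mul.
  apply: (@leq_trans (1 + #|` V| * (#|` V| ^ 4 * #|` P'| + 1))%N).
    by rewrite add1n ltnS; apply: leq_mul => //; rewrite /M addn1 ltnS.
  have V5 : (#|` V| <= #|` V| ^ 5)%N by rewrite -[leqLHS]expn1 leq_pexp2l.
  have V5' : (1 <= #|` V| ^ 5)%N by rewrite expn_gt0 V0.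
  rewrite mulnDr muln1 mulnA -expnS mulnC.
  by nia.
Qed.

End Coloring.

(** * Replacing windows by fillings of least energy *)

Lemma digits_inj (q N : nat) (a b : nat -> nat) :
  (forall n, a n < q)%N -> (forall n, b n < q)%N ->
  (\sum_(n < N) a n * q ^ n = \sum_(n < N) b n * q ^ n)%N ->
  forall n, (n < N)%N -> a n = b n.
Proof.
elim: N a b => [//|N IH] a b aq bq.
have q0 : (0 < q)%N by apply: leq_trans (aq 0%N).
have shift (d : nat -> nat) :
    (\sum_(n < N.+1) d n * q ^ n = (\sum_(n < N) d n.+1 * q ^ n) * q + d 0)%N.
  rewrite big_ord_recl expn0 muln1 addnC; congr addn.
  by rewrite big_distrl; apply: eq_bigr => i _; rewrite expnSr mulnA.
rewrite !shift => ab.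
have ab0 : a 0%N = b 0%N.
  by have := congr1 (modn^~ q) ab; rewrite !modnMDl !modn_small.
case=> [//|n]; rewrite ltnS => nN.
apply: (IH (fun n => a n.+1) (fun n => b n.+1)) => //.
by apply/eqP; rewrite -(eqn_pmul2r q0); apply/eqP; move: ab; rewrite ab0 => /addIn.
Qed.

(** As [w] is injective, each [j] owns a place in the base [q] expansion. *)
Lemma weighted_digits_inj (J : finType) (q : nat) (w a b : J -> nat) :
  (0 < q)%N -> injective w -> (forall j, a j < q)%N -> (forall j, b j < q)%N ->
  (\sum_j a j * q ^ w j = \sum_j b j * q ^ w j)%N -> a =1 b.
Proof.
move=> q0 winj aq bq.
have [N wN] : exists N, forall j, (w j < N)%N.
  by exists (\max_j w j).+1 => j; rewrite ltnS (leq_bigmax j).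
pose dig (d : J -> nat) n := (\sum_(j | w j == n) d j)%N.
have digw d j : dig d (w j) = d j.
  by rewrite /dig (eq_bigl (pred1 j)) ?big_pred1_eq// => k; rewrite (inj_eq winj).
have digq d : (forall j, d j < q)%N -> forall n, (dig d n < q)%N.
  move=> dq n; have [/existsP[j /eqP <-]|/existsPn nw] := boolP [exists j, w j == n].
    by rewrite digw.
  by rewrite /dig big_pred0 => [|j]; [exact: q0|exact/negbTE].
have digE d : (\sum_j d j * q ^ w j = \sum_(n < N) dig d n * q ^ n)%N.
  rewrite (partition_big (fun j => Ordinal (wN j)) xpredT)//=; apply: eq_bigr => n _.
  rewrite big_distrl /=; apply: eq_big => [j|j /eqP <-//].
  by rewrite -(inj_eq val_inj).
rewrite !digE => ab j; rewrite -(digw a) -(digw b).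
by apply: (digits_inj (digq _ aq) (digq _ bq) ab).
Qed.

Section Process.
Variables (G : groupType) (A I : finType).
Variables (K F : {fset G}) (L : set {ffun K -> A}) (i0 : I).
Hypothesis K1 : (1%g \in K).

Implicit Types (c : config G I) (x y : config G A) (T : pred G).

Definition view (B : finType) (g : G) (x : config G B) : config G B :=
  fun h => x (g * h)%g.

Definition window : {fset G} := fmul F (finv K).
(** A translate of [K] that meets this set lies in [F]. *)
Definition inside : {fset G} := core (fmul (finv K) K) F.

(* Sites of a window that must keep their letter: those near its boundary, so that
   [K]-patterns stay legal, and those near points of colour [i0], so that no
   [K]-pattern of the original shift is lost. *)
Definition frozen c f : bool :=
  (f \notin inside) || [exists k : K, c (f * (val k)^-1)%g == i0].

(** Here [y] is an arbitrary extension of [p] to the group; only translates of [K] inside [F] are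
    tested, so its letters outside [F] do not matter. *)
Definition filling c x (p : {ffun F -> A}) : bool :=
  `[< (forall f : F, frozen c (val f) -> p f = x (val f)) /\
      (forall h, (forall k, k \in K -> (h * k)%g \in F) ->
       forall y, pattern F y = p -> L (pattern K (view h y))) >].

(* The position-dependent weights make distinct fillings of a window carrying
   distinct colours have distinct energies. *)
Definition energy c (p : {ffun F -> A}) : nat :=
  (\sum_(f : F) enum_rank (p f) * #|A| ^ enum_rank (c (val f)))%N.

Definition best c x : {ffun F -> A} :=
  [arg min_(p < pattern F x | filling c x p) energy c p].

(** [T] selects the centres allowed to act: all of them in the true process, those with their window
    in a finite set in its confined version. *)
Definition step T i c x : config G A := fun h =>
  if [pick f : F | (c (h * (val f)^-1)%g == i) && T (h * (val f)^-1)%g] is Some f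
  then best (view (h * (val f)^-1)%g c) (view (h * (val f)^-1)%g x) f
  else x h.

Definition run T (s : seq I) c x : config G A := foldl (fun x i => step T i c x) x s.

(** A site counts as changed even if a later step restores its letter. *)
Fixpoint changed T (s : seq I) c x h : bool :=
  if s is i :: s' then
    (step T i c x h != x h) || changed T s' c (step T i c x) h
  else false.

Definition legal x := forall g, L (pattern K (view g x)).

Definition proper (P : {fset G}) c :=
  forall g h, (g^-1 * h)%g \in P -> c g = c h -> g = h.

Lemma sub_window f : f \in F -> f \in window.
Proof.
by move=> fF; rewrite -(mulg1 f); apply: mem_fmul => //; rewrite mem_finv invg1.
Qed.

Lemma frozen_local c c' f : f \in F -> {in window, c =1 c'} -> frozen c f = frozen c' f.
Proof.
move=> fF cc'; rewrite /frozen; congr (_ || _); apply: eq_existsb => k.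
by rewrite cc'//; apply: mem_fmul => //; rewrite mem_finv invgK; exact: fsvalP.
Qed.

Lemma filling_local c c' x y : {in window, c =1 c'} ->
  (forall f, f \in F -> frozen c f -> x f = y f) -> filling c x = filling c' y.
Proof.
move=> cc' xy; apply/funext => p; apply: asbool_equiv_eq; split=> -[px pL].
  split=> // f ff; rewrite -xy ?fsvalP ?(frozen_local _ cc') ?fsvalP//.
  by rewrite px// (frozen_local _ cc') ?fsvalP.
split=> // f ff; rewrite xy ?fsvalP// px// -(frozen_local _ cc') ?fsvalP//.
Qed.

Lemma energy_local c c' : {in window, c =1 c'} -> energy c = energy c'.
Proof.
move=> cc'; apply/funext => p; apply: eq_bigr => f _.
by rewrite cc'//; apply: sub_window; exact: fsvalP.
Qed.

Lemma best_local c c' x y : {in window, c =1 c'} -> {in F, x =1 y} ->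
  best c x = best c' y.
Proof.
move=> cc' xy; rewrite /best (energy_local cc').
rewrite (@filling_local c c' x y)// => [|f fF _]; last exact: xy.
by have -> : pattern F x = pattern F y by apply/patternP.
Qed.

Lemma filling_self c x : legal x -> filling c x (pattern F x).
Proof.
move=> Lx; apply/asboolP; split=> [f _|h hK y /patternP yx]; first by rewrite ffunE.
have -> : pattern K (view h y) = pattern K (view h x); last exact: Lx.
by apply/patternP => k kK; apply: yx; exact: hK.
Qed.

Lemma legal_view g x : legal x -> legal (view g x).
Proof.
move=> Lx h; have -> : view h (view g x) = view (g * h)%g x; last exact: Lx.
by apply/funext => k; rewrite /view mulgA.
Qed.

Lemma bestP c x : legal x ->
  filling c x (best c x) /\ forall p, filling c x p -> (energy c (best c x) <= energy c p)%N.
Proof.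
by move=> Lx; rewrite /best; case: arg_minnP => [|p]; [exact: filling_self|].
Qed.

Lemma energy_inj c p p' : {in F &, injective c} -> energy c p = energy c p' -> p = p'.
Proof.
move=> cinj pp'; apply/ffunP => f; apply: enum_rank_inj; apply: ord_inj.
have A0 : (0 < #|A|)%N by apply/card_gt0P; exists (p f).
apply: (@weighted_digits_inj F #|A| (fun f => enum_rank (c (val f)))
  (fun f => enum_rank (p f)) (fun f => enum_rank (p' f))) => //.
by move=> g h /ord_inj/enum_rank_inj/cinj gh; apply/val_inj/gh; exact: fsvalP.
Qed.

(** Both sides minimise over the same set of fillings, and distinct fillings have distinct energies,
    so neither the unfrozen letters nor the default of the minimum matter. *)
Lemma best_frozen c c' x y : legal x -> legal y ->
  {in window, c =1 c'} -> {in F &, injective c} ->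
  (forall f, f \in F -> frozen c f -> x f = y f) -> best c x = best c' y.
Proof.
move=> Lx Ly cc' cinj xy; apply: (energy_inj cinj); apply/eqP; rewrite eqn_leq.
have [fx xmin] := bestP c Lx; have [fy ymin] := bestP c' Ly.
have xyE := filling_local cc' xy; rewrite xmin ?xyE// [in X in _ && X](energy_local cc').
by rewrite ymin// -xyE.
Qed.

Section Steps.
Variables (P : {fset G}) (c : config G I).
Hypothesis cP : proper P c.
Hypothesis FFP : {subset fmul F (finv F) <= P}.
Hypothesis FFP' : {subset fmul (finv F) F <= P}.

Lemma view_inj u : {in F &, injective (view u c)}.
Proof.
move=> f f' fF f'F /cP ff'; apply: (mulgI u); apply: ff'.
rewrite invgM -mulgA mulKg; apply: FFP'; apply: mem_fmul => //.
by rewrite mem_finv invgK.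
Qed.

Lemma step_in T i x u (f : F) : c u = i -> T u ->
  step T i c x (u * val f)%g = best (view u c) (view u x) f.
Proof.
move=> cu Tu; rewrite /step; case: pickP => [f' /andP[/eqP cf' _]|/(_ f)]; last first.
  by rewrite mulgK cu eqxx Tu.
have uE : u = (u * val f / val f')%g.
  apply: cP; rewrite ?cu ?cf'// mulgA mulKg; apply: FFP.
  by apply: mem_fmul; rewrite ?mem_finv ?invgK; exact: fsvalP.
rewrite -uE; congr (best _ _ _); apply: val_inj; apply: (mulgI u).
by rewrite [in LHS]uE mulgVK.
Qed.

Variant step_spec T i x h : A -> Type :=
| StepIn u (f : F) of h = (u * val f)%g & c u = i & T u :
    step_spec T i x h (best (view u c) (view u x) f)
| StepOut of (forall f : F, ~~ ((c (h / val f)%g == i) && T (h / val f)%g)) :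
    step_spec T i x h (x h).

Lemma stepP T i x h : step_spec T i x h (step T i c x h).
Proof.
rewrite /step; case: pickP => [f /andP[/eqP cf Tf]|nf]; last by right => f; rewrite nf.
by left => //; rewrite mulgVK.
Qed.

Lemma step_frozen T i x u (f : F) : legal x -> c u = i -> T u ->
  frozen (view u c) (val f) -> step T i c x (u * val f)%g = x (u * val f)%g.
Proof.
move=> Lx cu Tu uf; rewrite step_in//.
have [/asboolP[fr _] _] := bestP (view u c) (legal_view u Lx).
exact: fr.
Qed.

Lemma step_protected T i x g k : legal x -> c g = i0 -> k \in K ->
  step T i c x (g * k)%g = x (g * k)%g.
Proof.
move=> Lx cg kK; case: stepP => // u f gk cu Tu; rewrite gk -(step_in x f cu Tu).
apply: step_frozen => //; apply/orP; right; apply/existsP; exists [` kK]%fset => /=.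
by rewrite /view mulgA -gk mulgK cg.
Qed.

(** A translate of [K] that meets the inside of a rewritten window lies in that window, where the
    filling is legal. Any other translate keeps all its letters, since sites outside [inside] are
    frozen. *)
Lemma step_legal T i x : legal x -> legal (step T i c x).
Proof.
move=> Lx g.
have [[k [u [f [kK gk cu Tu fin]]]]|none] := EM (exists k u (f : F),
    [/\ k \in K, (g * k)%g = (u * val f)%g, c u = i, T u & val f \in inside]).
  have [/asboolP[_ pL] _] := bestP (view u c) (legal_view u Lx).
  have /coreP[_ fK] := fin.
  have gE : g = (u * val f / k)%g by rewrite -gk mulgK.
  have hK l : l \in K -> (u^-1 * g * l)%g \in F.
    move=> lK; have := fK (k^-1 * l)%g; rewrite gE !mulgA mulVg mul1g => -> //.
    by apply: mem_fmul => //; rewrite mem_finv invgK.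
  have := pL (u^-1 * g)%g hK (view u (step T i c x)).
  have -> : view (u^-1 * g)%g (view u (step T i c x)) = view g (step T i c x).
    by apply/funext => h; rewrite /view !mulgA mulgV mul1g.
  by apply; apply/ffunP => e; rewrite ffunE /view step_in.
have -> : pattern K (view g (step T i c x)) = pattern K (view g x); last exact: Lx.
apply/patternP => k kK; rewrite /view.
case: stepP => // u f gk cu Tu; rewrite gk -(step_in x f cu Tu).
apply: step_frozen => //; apply/orP; left.
by apply/negP => fin; apply: none; exists k, u, f.
Qed.

Lemma run_legal T s x : legal x -> legal (run T s c x).
Proof. by elim: s x => [//|i s IH] x Lx; apply/IH/step_legal. Qed.

Lemma run_protected T s x g k : legal x -> c g = i0 -> k \in K ->
  run T s c x (g * k)%g = x (g * k)%g.
Proof.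
elim: s x => [//|i s IH] x Lx cg kK /=.
by rewrite /run /= -/(run T s c _) IH//; [exact: step_protected|exact: step_legal].
Qed.

(** When the colour of [u] comes up, its window receives the best filling; as nothing there changes
    during the pass, that filling was present from the start. *)
Lemma unchanged_best T s x u : legal x -> T u -> c u \in s ->
  (forall f, f \in F -> ~~ changed T s c x (u * f)%g) ->
  forall f : F, x (u * val f)%g = best (view u c) (view u x) f.
Proof.
move=> Lx Tu; elim: s x Lx => [//|i s IH] x Lx cus nch f.
have xx f' : f' \in F -> step T i c x (u * f')%g = x (u * f')%g.
  by move=> /nch /=; rewrite negb_or negbK => /andP[/eqP].
move: cus; rewrite inE => /orP[/eqP cu|cus].
  by rewrite -xx ?fsvalP// step_in.
rewrite -xx ?fsvalP// (IH (step T i c x))//.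
- by congr (fun_of_fin _ f); apply: best_local => // f' f'F; exact: xx.
- exact: step_legal.
- by move=> f' /nch /=; rewrite negb_or => /andP[].
Qed.

(** * Bounding the number of changes by an energy *)

Section Cost.
Variables (O : {fset G}) (T : pred G).
Hypothesis TO : forall u f, T u -> f \in F -> (u * f)%g \in O.

Definition cost x := (\sum_(h <- O) enum_rank (x h) * #|A| ^ enum_rank (c h))%N.

(** Windows of one colour are disjoint. A modified window loses at least one unit of energy and
    changes at most as many sites as [F] has, whence the factor. *)
Lemma step_cost i x : legal x ->
  (\sum_(h <- O) (step T i c x h != x h) + #|` F| * cost (step T i c x) <=
   #|` F| * cost x)%N.
Proof.
move=> Lx; rewrite /cost !big_distrr/= -big_split/=.
pose q := #|A|; pose n := #|` F|.
pose w h := (q ^ enum_rank (c h))%N.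
pose x' := step T i c x.
pose a h := ((x' h != x h) + n * (enum_rank (x' h) * w h))%N.
pose b h := (n * (enum_rank (x h) * w h))%N.
rewrite -[leqLHS]/(\sum_(h <- O) a h)%N -[leqRHS]/(\sum_(h <- O) b h)%N.
pose U := [fset u in fmul O (finv F) | (c u == i) && T u]%fset.
have U_P u : u \in U -> c u = i /\ T u by rewrite !inE/= => /andP[_ /andP[/eqP]].
pose D := fmul U F.
have sumD (d : G -> nat) :
    (\sum_(h <- D) d h = \sum_(u <- U) \sum_(f : F) d (u * val f)%g)%N.
  rewrite (perm_big [seq (u * f)%g | u <- U, f <- F]); last first.
    apply: uniq_perm; rewrite ?fset_uniq//; last first.
      move=> h; apply/fmulP/allpairsP => [[u uU [f fF ->]]|[[u f] /= [uU fF ->]]].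
        by exists (u, f).
      by exists u => //; exists f.
    apply: allpairs_uniq; rewrite ?fset_uniq// => -[u f] [u' f'].
    move=> /allpairsP[[u1 f1] /= [uU fF [? ?]]]; subst u1 f1.
    move=> /allpairsP[[u1 f1] /= [u'U f'F [? ?]]] /= uf; subst u1 f1.
    have [cu _] := U_P _ uU; have [cu' _] := U_P _ u'U.
    have uu' : u = u'.
      apply: cP; last by rewrite cu cu'.
      have -> : (u^-1 * u' = f * f'^-1)%g by rewrite -[u'](mulgK f') -uf -!mulgA mulKg.
      by apply: FFP; apply: mem_fmul; rewrite ?mem_finv ?invgK.
    by move: uf; rewrite uu' => /mulgI ->.
  by rewrite big_allpairs_dep; apply: eq_bigr => u _; rewrite big_seq_fsetE.
have DO : [fset h in O | h \in D]%fset = D.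
  apply/fsetP => h; rewrite !inE/= andb_idl// => /fmulP[u /U_P[_ Tu] [f fF ->]].
  exact: TO.
(* Sites outside [D], the union of the acting windows, keep their letters; on [D] the sums split
   into windows by [sumD]. *)
rewrite (bigID (mem D)) [leqRHS](bigID (mem D))/=; apply: leq_add; last first.
  apply: leq_sum => h hD; have : x' h = x h.
    rewrite /x'; case: stepP => // u f hE cu Tu; move/negP: hD; case.
    rewrite hE; apply: mem_fmul; last exact: fsvalP.
    rewrite !inE/= cu eqxx Tu !andbT -(mulgK (val f) u); apply: mem_fmul.
      exact: TO (fsvalP f).
    by rewrite mem_finv invgK fsvalP.
  by rewrite /a /b => ->; rewrite eqxx.
rewrite big_fset_condE [leqRHS]big_fset_condE DO !sumD big_seq [leqRHS]big_seq.
apply: leq_sum => u /U_P[cu Tu].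
have [fil bmin] := bestP (view u c) (legal_view u Lx).
have x'E (f : F) : x' (u * val f)%g = best (view u c) (view u x) f by exact: step_in.
have xE (f : F) : x (u * val f)%g = pattern F (view u x) f by rewrite ffunE.
have [best_eq|best_neq] := eqVneq (best (view u c) (view u x)) (pattern F (view u x)).
  by apply: leq_sum => f _; rewrite /a /b x'E xE best_eq eqxx.
rewrite /a /b big_split/= -!big_distrr/=.
set E' := (\sum_f _ * _)%N; set E := (\sum_f _ * _)%N.
have EE : (E' < E)%N.
  have -> : E = energy (view u c) (pattern F (view u x)).
    by apply: eq_bigr => f _; rewrite xE.
  have -> : E' = energy (view u c) (best (view u c) (view u x)).
    by apply: eq_bigr => f _; rewrite x'E.
  rewrite ltn_neqAle bmin ?filling_self ?legal_view//; last exact: legal_view.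
  by rewrite andbT; apply: contra_neq best_neq; apply: energy_inj; exact: view_inj.
apply: (@leq_trans (n + n * E')); last by rewrite -mulnS leq_mul2l EE orbT.
rewrite leq_add2r /n cardfE -sum1_card; apply: leq_sum => f _; exact: leq_b1.
Qed.

Lemma changed_cost s x : legal x ->
  (\sum_(h <- O) changed T s c x h + #|` F| * cost (run T s c x) <=
   #|` F| * cost x)%N.
Proof.
elim: s x => [|i s IH] x Lx; first by rewrite big1.
apply: leq_trans (step_cost i Lx).
apply: (@leq_trans (\sum_(h <- O) (step T i c x h != x h) +
   (\sum_(h <- O) changed T s c (step T i c x) h +
    #|` F| * cost (run T s c (step T i c x))))%N); last first.
  by rewrite leq_add2l; apply/IH/step_legal.
rewrite addnA leq_add2r -big_split/=; apply: leq_sum => h _.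
by case: (_ != _); case: changed.
Qed.

Lemma cost_le x : (cost x <= #|` O| * #|A| ^ #|I|.+1)%N.
Proof.
rewrite /cost; apply: (@leq_trans (\sum_(h <- O) #|A| ^ #|I|.+1)%N); last first.
  by rewrite big_const_seq count_predT iter_addn_0 mulnC.
apply: leq_sum => h _; have A0 : (0 < #|A|)%N by apply/card_gt0P; exists (x h).
rewrite expnS leq_mul//; first exact/ltnW/ltn_ord.
by rewrite leq_pexp2l//; exact/ltnW/ltn_ord.
Qed.

(** [changed_cost] telescopes over the [N] passes, so the initial cost bounds all changes together;
    the pass with fewest changes does not exceed the average. *)
Lemma exists_quiet_pass s x N : (0 < N)%N -> legal x ->
  exists2 t, (t < N)%N &
    (N * \sum_(h <- O) changed T s c (iter t (run T s c) x) h <=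
      #|` F| * (#|` O| * #|A| ^ #|I|.+1))%N.
Proof.
move=> N0 Lx; pose ch t := (\sum_(h <- O) changed T s c (iter t (run T s c) x) h)%N.
have Lt t : legal (iter t (run T s c) x).
  by elim: t => [//|t IH]; rewrite iterS; exact: run_legal.
have tot : (\sum_(t < N) ch t + #|` F| * cost (iter N (run T s c) x) <=
            #|` F| * cost x)%N.
  elim: N {N0} => [|N IH]; first by rewrite big_ord0.
  rewrite big_ord_recr/= -addnA; apply: leq_trans IH; rewrite leq_add2l.
  exact: changed_cost.
have [t _ tmin] := @arg_minnP _ (Ordinal N0) xpredT (fun t : 'I_N => ch t) isT.
exists t => //; rewrite -/(ch t).
apply: (@leq_trans (\sum_(t' < N) ch t')%N).
  rewrite -[X in (X * _ <= _)%N]card_ord -sum_nat_const.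
  by apply: leq_sum => t' _; exact: tmin.
apply: leq_trans (leq_trans (leq_addr _ _) tot) _.
by rewrite leq_mul2l cost_le orbT.
Qed.

End Cost.
End Steps.
End Process.

(** * Locality of the process and its confinement to a finite set *)

Section Locality.
Variables (G : groupType) (A I : finType).
Variables (K F : {fset G}) (L : set {ffun K -> A}) (i0 : I).
Hypothesis K1 : (1%g \in K).

Implicit Types (c : config G I) (x y : config G A) (T : pred G) (O : {fset G}).

Local Notation step := (@step G A I K F L i0).
Local Notation run := (@run G A I K F L i0).
Local Notation best := (@best G A I K F L i0).
Local Notation window := (window K F).

(** Allowing two base points and two predicates covers both the block code property and the
    comparison with the confined process. *)
Lemma step_local T T' i c c' x x' g h :
  (forall f, f \in F -> ((c (g / f)%g == i) && T (g / f)%g) =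
                        ((c' (h / f)%g == i) && T' (h / f)%g)) ->
  (forall f, f \in F -> c (g / f)%g = i -> T (g / f)%g ->
     {in window, view (g / f)%g c =1 view (h / f)%g c'} /\
     {in F, view (g / f)%g x =1 view (h / f)%g x'}) ->
  x g = x' h -> step T i c x g = step T' i c' x' h.
Proof.
move=> cT loc xg.
rewrite /step.
have -> : [pick f : F | (c' (h / val f)%g == i) && T' (h / val f)%g] =
          [pick f : F | (c (g / val f)%g == i) && T (g / val f)%g].
  by apply: eq_pick => f; rewrite /= -cT//; exact: fsvalP.
case: pickP => // f /andP[/eqP cf Tf].
have [cc' xx'] := loc _ (fsvalP f) cf Tf.
by congr (fun_of_fin _ f); exact: best_local.
Qed.

(** Contains the displacements from a site to the centres that may act on it and to the windows of
    these centres. *)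
Definition radius : {fset G} := fmul (1%g |` finv F)%fset (1%g |` window)%fset.

Lemma radius1 : (1%g \in radius).
Proof. by rewrite -(mulg1 1%g); apply: mem_fmul; rewrite !inE eqxx. Qed.

Lemma radiusV f : f \in F -> f^-1%g \in radius.
Proof.
move=> fF; rewrite -(mulg1 f^-1%g); apply: mem_fmul; rewrite !inE ?eqxx//.
by rewrite mem_finv invgK fF orbT.
Qed.

Lemma radiusW f w : f \in F -> w \in window -> (f^-1 * w)%g \in radius.
Proof.
move=> fF wW; apply: mem_fmul; rewrite !inE ?wW ?orbT//.
by rewrite mem_finv invgK fF orbT.
Qed.

Definition run_pair s (z : config G (A * I)%type) : config G (A * I)%type :=
  fun g => (run predT s (snd \o z) (fst \o z) g, (z g).2).

Lemma run_pair_code s : exists N, block_code N (run_pair s).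
Proof.
elim: s => [|i s [N IH]].
  exists [fset 1%g]%fset => x y g h xy; rewrite /run_pair /run /=.
  by have := xy 1%g; rewrite inE eqxx !mulg1 => /(_ isT) ->.
have code1 : block_code radius (run_pair [:: i]).
  move=> x y g h xy; have xyg : x g = y h.
    by have := xy 1%g radius1; rewrite !mulg1.
  rewrite /run_pair xyg; congr pair; apply: step_local.
  - by move=> f fF /=; rewrite xy ?radiusV.
  - move=> f fF _ _; split=> w wW; rewrite /view /= -!mulgA xy// radiusW//.
    exact: sub_window.
  - by rewrite /= xyg.
exists (fmul N radius); exact: block_code_comp code1 IH.
Qed.

Definition inside_of O : pred G := fun u => (lmul u (1%g |` window) `<=` O)%fset.

Lemma inside_ofP O u :
  reflect (u \in O /\ forall w, w \in window -> (u * w)%g \in O) (inside_of O u).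
Proof.
apply: (iffP idP) => [/fsubsetP uO|[uO uW]]; last apply/fsubsetP => h.
  split=> [|w wW]; apply: uO; rewrite mem_lmul ?mulVg ?mulKg !inE ?eqxx//.
  by rewrite wW orbT.
rewrite mem_lmul !inE => /orP[/eqP uh|/uW]; last by rewrite mulVKg.
by rewrite -(mulVKg u h) uh mulg1.
Qed.

Fixpoint radius_iter n : {fset G} :=
  if n is n'.+1 then fmul (radius_iter n') radius else [fset 1%g]%fset.

(** Each step spreads the effect of a suppressed centre by at most one [radius], so deep inside [O]
    the true and the confined process agree. *)
Lemma run_inside O s c x x' h :
  (forall n, n \in radius_iter (size s) -> (h * n)%g \in O /\ x (h * n)%g = x' (h * n)%g) ->
  run predT s c x h = run (inside_of O) s c x' h.
Proof.
elim: s x x' h => [|i s IH] x x' h hO /=.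
  by have [|_] := hO 1%g; rewrite ?inE//= mulg1.
apply: (IH (step predT i c x) (step (inside_of O) i c x')) => n nk.
have hOr r : r \in radius -> (h * n * r)%g \in O /\ x (h * n * r)%g = x' (h * n * r)%g.
  by move=> rR; rewrite -!mulgA; apply: hO; exact: mem_fmul.
have [hnO xhn] := hOr 1%g radius1; rewrite mulg1 in hnO xhn; split=> //.
apply: step_local => //.
  move=> f fF; congr andb; apply/esym/inside_ofP; split.
    by have [] := hOr f^-1%g (radiusV fF).
  by move=> w wW; rewrite -mulgA; have [] := hOr _ (radiusW fF wW).
move=> f fF _ _; split=> // w wW; rewrite /view -mulgA.
by have [] := hOr _ (radiusW fF (sub_window K1 wW)).
Qed.

(** An acting centre has its whole window in [O], so nothing outside [O] is read. *)
Lemma run_inside_det O s c c' x x' : {in O, c =1 c'} -> {in O, x =1 x'} ->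
  {in O, run (inside_of O) s c x =1 run (inside_of O) s c' x'}.
Proof.
move=> cc'; elim: s x x' => [//|i s IH] x x' xx' /=.
apply: IH => h hO; apply: step_local; last exact: xx'.
  move=> f fF; case Tf: (inside_of O _); rewrite ?andbF// cc'//.
  by have /inside_ofP[] := Tf.
move=> f fF _ /inside_ofP[_ Tf]; split=> w wW; rewrite /view.
  by apply: cc'; exact: Tf.
by apply: xx'; apply: Tf; exact: sub_window.
Qed.

Lemma run_nseq T s N c x : run T (flatten (nseq N s)) c x = iter N (run T s c) x.
Proof.
elim: N x => [//|N IH] x; rewrite iterSr -IH /=.
by rewrite /run foldl_cat.
Qed.

End Locality.

(** * Counting the final patterns *)

Section Counting.
Variables (R : realType) (G : groupType) (A I : finType).
Variables (K F P : {fset G}) (L : set {ffun K -> A}) (i0 : I).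
Hypotheses (K1 : (1%g \in K)) (F0 : F != fset0).
Hypothesis FFP : {subset fmul F (finv F) <= P}.
Hypothesis FFP' : {subset fmul (finv F) F <= P}.
Hypothesis WWP : {subset fmul (finv (window K F)) (window K F) <= P}.

Local Notation step := (@step G A I K F L i0).
Local Notation run := (@run G A I K F L i0).
Local Notation changed := (@changed G A I K F L i0).
Local Notation frozen := (@frozen G I K F i0).
Local Notation best := (@best G A I K F L i0).
Local Notation window := (window K F).
Local Notation inside_of := (@inside_of G K F).
Local Notation legal := (@legal G A K L).

Implicit Types (c : config G I) (O : {fset G}).

(** Centres of colour [i0] whose translate of [K] meets [F] lie in [window], where [WWP] leaves room
    for only one; it freezes at most one copy of [K]. *)
Lemma card_frozen c : proper P c ->
  (#|` [fset f in F | frozen c f]%fset| <= #|` F `\` inside K F|%fset + #|` K|)%N.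
Proof.
move=> cP; pose D := [fset f in F | [exists k : K, c (f / val k)%g == i0]]%fset.
apply: (@leq_trans (#|` (F `\` inside K F) `|` D|%fset)).
  apply: fsubset_leq_card; apply/fsubsetP => f; rewrite mem_sep_fset in_fsetU in_fsetD /D mem_sep_fset.
  by rewrite /frozen; case: (f \in inside K F) => /= /andP[->].
apply: leq_trans (leq_addr #|` (F `\` inside K F) `&` D|%fset _) _.
rewrite cardfsUI leq_add2l.
have [->|[f0]] := fset_0Vmem D; first by rewrite cardfs0.
rewrite !inE/= => /andP[f0F /existsP[k0 /eqP ck0]].
rewrite -(card_lmul (f0 / val k0)%g K); apply: fsubset_leq_card; apply/fsubsetP => f.
rewrite !inE/= => /andP[fF /existsP[k /eqP ck]].
have wW g (l : K) : g \in F -> (g / val l)%g \in window.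
  by move=> gF; apply: mem_fmul => //; rewrite mem_finv invgK; exact: fsvalP.
have -> : (f0 / val k0)%g = (f / val k)%g.
  apply: cP; rewrite ?ck0 ?ck//; apply: WWP; apply: mem_fmul; rewrite ?wW//.
  by rewrite mem_finv invgK wW.
by rewrite mem_lmul invgM invgK -mulgA mulVg mulg1 fsvalP.
Qed.

(** Shearer's inequality over the translates of [F]. A translate with its window in [O] that avoids
    [D] carries its best filling, so its frozen sites determine it; the translates in [bad] get the
    trivial bound. *)
Lemma frozen_count O c0 (D : {fset G}) (Y : set (config G A)) (s : seq I) :
  proper P c0 -> (forall i, i \in s) ->
  (forall y, Y y -> legal y /\ exists c, [/\ proper P c, {in O, c =1 c0} &
     forall h, h \notin D -> ~~ changed (inside_of O) s c y h]) ->
  (npat Y O ^ #|` F| <= #|A| ^ ((#|` F `\` inside K F|%fset + #|` K|) * #|` fmul O (finv F)| +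
     #|` F| * (#|` [fset u in fmul O (finv F) | ~~ inside_of O u]%fset| + #|` D| * #|` F|)))%N.
Proof.
move=> c0P sI YP.
have [Y0|Y0] := EM (Y !=set0); last first.
  have -> : npat Y O = 0%N by apply/eqP; rewrite -leqn0 leqNgt; apply/negP => /nval_gt0.
  by rewrite exp0n// cardfs_gt0.
have A0 : (0 < #|A|)%N by have [y _] := Y0; apply/card_gt0P; exists (y 1%g).
pose J := fmul O (finv F).
pose bad := ([fset u in J | ~~ inside_of O u] `|` fmul D (finv F))%fset.
have badle : (#|` bad| <= #|` [fset u in J | ~~ inside_of O u]%fset| + #|` D| * #|` F|)%N.
  apply: leq_trans (leq_addr #|` [fset u in J | ~~ inside_of O u] `&` fmul D (finv F)|%fset _) _.
  by rewrite cardfsUI leq_add2l -(card_finv F) card_fmul.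
apply: leq_trans (@shearer R G A J (fun u => lmul (val u) F) #|` F| O Y _ _) _.
- by rewrite cardfs_gt0.
- by move=> w wO; exact: card_translates.
set m := (_ + #|` K|)%N.
apply: (@leq_trans (\prod_(u <- J) #|A| ^ (m + (if u \in bad then #|` F| else 0)))%N).
  rewrite big_seq_fsetE; apply: leq_prod => -[u uJ] _ /=.
  have [ubad|ugood] := ifPn.
    apply: leq_trans (nval_pattern_le _ _) _; rewrite card_lmul.
    by rewrite leq_pexp2l// leq_addl.
  rewrite addn0; pose Fr := [fset f in F | frozen (view u c0) f]%fset.
  have uP c : proper P c -> proper P (view u c).
    move=> cP g h gh /cP ugh; apply: (mulgI u); apply: ugh.
    by rewrite invgM -mulgA mulKg.
  apply: (@leq_trans (nval Y (pattern (lmul u Fr)))); last first.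
    apply: leq_trans (nval_pattern_le _ _) _; rewrite card_lmul leq_pexp2l//.
    exact/card_frozen/uP.
  have ins : inside_of O u.
    by apply: contraNT ugood => nins; rewrite !inE/= uJ nins.
  have nch f : f \in F -> (u * f)%g \notin D.
    move=> fF; apply: contra ugood => ufD; rewrite inE; apply/orP; right.
    by rewrite -(mulgK f u); apply: mem_fmul => //; rewrite mem_finv invgK.
  have /inside_ofP[_ uW] := ins.
  apply: leq_nval_fun => y y' /YP[Ly [c [cP cc0 nchc]]] /YP[Ly' [c' [c'P c'c0 nchc']]].
  move=> /patternP yy'; apply/patternP => h; rewrite mem_lmul => hF.
  have ub z d : legal z -> proper P d -> (forall h, h \notin D -> ~~ changed (inside_of O) s d z h) ->
      z h = best (view u d) (view u z) [` hF]%fset.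
    move=> Lz dP zD; have := @unchanged_best _ _ _ _ _ L i0 K1 P d dP FFP (inside_of O) s z u Lz ins (sI _) _ [` hF]%fset.
    by rewrite /= mulVKg; apply => f fF; exact/zD/nch.
  rewrite (ub y c)// (ub y' c')//; congr (fun_of_fin _ _).
  have cc'W : {in window, view u c =1 view u c'}.
    by move=> w /uW uwO; rewrite /view cc0// c'c0.
  apply: best_frozen => //; [exact: legal_view|exact: legal_view|exact: view_inj FFP' _|].
  move=> f fF ff; apply: yy'; rewrite mem_lmul mulKg mem_sep_fset fF /=.
  rewrite -(frozen_local i0 fF (c := view u c))// => w /uW uwO.
  by rewrite /view cc0.
rewrite -expn_sum leq_pexp2l// big_split/= leq_add//.
  by rewrite big_const_seq count_predT iter_addn_0.
rewrite -big_mkcond/= big_const_seq iter_addn_0 leq_mul2l; apply/orP; right.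
apply: leq_trans badle; rewrite -size_filter.
apply: uniq_leq_size; first by rewrite filter_uniq// fset_uniq.
by move=> u; rewrite mem_filter => /andP[].
Qed.

Lemma changed_inside O s c x h : changed (inside_of O) s c x h -> h \in O.
Proof.
elim: s x => [//|i s IH] x /= /orP[|/IH//].
case: (@stepP _ _ _ K F L i0 c (inside_of O) i x h) => [u f -> _ /inside_ofP[_ uW] _|]; last by rewrite eqxx.
exact/uW/sub_window/fsvalP.
Qed.

Lemma radius_iter1 n : (1%g \in radius_iter K F n).
Proof.
elim: n => [|n IH] /=; first by rewrite inE.
by rewrite -(mulg1 1%g); apply: mem_fmul => //; exact: radius1.
Qed.

Lemma card_sep_fset (T : choiceType) (U : {fset T}) (Q : pred T) :
  #|` [fset u in U | Q u]%fset| = (\sum_(u <- U) Q u)%N.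
Proof.
rewrite -sum1_size -(big_fset_condE _ _ Q) big_mkcond /=.
by apply: eq_bigr => u _; case: (Q u).
Qed.

Lemma card_sep_fset_fin (T : choiceType) (U : {fset T}) (Q : pred T) :
  #|[set u : U | Q (val u)]%SET| = #|` [fset u in U | Q u]%fset|.
Proof.
rewrite card_sep_fset big_seq_fsetE -sum1_card big_mkcond /=.
by apply: eq_bigr => u _; rewrite finset.inE; case: (Q _).
Qed.

(* Every orbit has a pass with few changes. The patterns on [O] at the start of
   that pass, together with the colours, determine the final pattern on [O']. *)
Lemma quiet_pass_count (X : set (config G A)) (C : set (config G I)) O O' N m :
  (forall x, X x -> legal x) -> (forall c, C c -> proper P c) -> (0 < N)%N ->
  (forall h n, h \in O' -> n \in radius_iter K F (size (flatten (nseq N (enum I)))) ->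
     (h * n)%g \in O) ->
  let bound := (#|` F| * (#|` O| * #|A| ^ #|I|.+1))%N in
  (forall c0 (D : {fset G}) (Y : set (config G A)), proper P c0 ->
     (N * #|` D| <= bound)%N ->
     (forall y, Y y -> legal y /\ exists c, [/\ proper P c, {in O, c =1 c0} &
       forall h, h \notin D -> ~~ changed (inside_of O) (enum I) c y h]) ->
     (npat Y O <= m)%N) ->
  (npat (@run_pair _ _ _ K F L i0 (flatten (nseq N (enum I))) @`
          [set z | X (fst \o z) /\ C (snd \o z)]) O' <=
    N * npat C O * #|[pred D : {set O} | N * #|D| <= bound]| * m)%N.
Proof.
move=> XL CP N0 OO' bound Ym; set s := flatten _ in OO' *.
set Z := [set z | _]; rewrite /npat nval_image.
pose T := inside_of O; pose pass := enum I.
pose y t (z : config G (A * I)%type) := iter t (run T pass (snd \o z)) (fst \o z).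
pose ch t z h := changed T pass (snd \o z) (y t z) h.
have TF u f : T u -> f \in F -> (u * f)%g \in O.
  by move=> /inside_ofP[_ uW] fF; apply/uW/sub_window.
have /choice[tt ttP] (z : config G (A * I)%type) :
    exists t : 'I_N, Z z -> (N * \sum_(h <- O) ch t z h <= bound)%N.
  have [[Xz Cz]|nZ] := EM (Z z); last by exists (Ordinal N0).
  have [t tN tP] := @exists_quiet_pass _ _ _ _ _ L i0 P _ (CP _ Cz) FFP FFP' O T TF pass _ N N0 (XL _ Xz).
  by exists (Ordinal tN).
pose Dl z : {set O} := [set h : O | ch (tt z) z (val h)]%SET.
(* The classes record the index of the quiet pass, the colours on [O] and the set of sites changed
   in that pass. *)
pose Q := [pred g : 'I_N * {ffun O -> I} * {set O} |
  (g.1.2 \in [pred b | `[< (pattern O @` C) b >]]) && (N * #|g.2| <= bound)%N].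
apply: (@leq_trans (#|Q| * m)); last first.
  rewrite leq_mul2r; apply/orP; right.
  rewrite -[X in (X * _ * _)%N]card_ord -!cardX; apply: eq_leq; apply: eq_card => -[[t b] D].
  by rewrite !inE.
apply: (leq_nval_fiber_const (g := fun z => (tt z, pattern O (snd \o z), Dl z))).
  move=> z Zz; rewrite /Q inE /=; apply/andP; split.
    by apply/nvalP; exists (snd \o z) => //; case: Zz.
  by rewrite card_sep_fset_fin card_sep_fset; exact: ttP.
move=> [[t b] D] _; set E := _ `&` _.
have [[z0 [Zz0 /= [tz0 bz0 Dz0]]]|E0] := EM (E !=set0); last first.
  by rewrite (_ : nval _ _ = 0%N)//; apply/eqP; rewrite -leqn0 leqNgt; apply/negP => /nval_gt0.
(* Within a class, the letters on [O] before pass [t] determine the outcome of the remaining [N - t]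
   confined passes, hence the final pattern on [O']. *)
apply: (@leq_trans (nval E (pattern O \o y t))).
  apply: leq_nval_fun => z z' [_ /= [_ bz _]] [_ /= [_ bz' _]] /patternP yy'.
  have cc' : {in O, snd \o z =1 snd \o z'} by apply/patternP; rewrite bz bz'.
  have it k : {in O, iter k (run T pass (snd \o z)) (y t z) =1
                     iter k (run T pass (snd \o z')) (y t z')}.
    by elim: k => [//|k IH] /=; apply: run_inside_det.
  apply/patternP => h hO'.
  have hO : h \in O by rewrite -(mulg1 h); apply: OO' => //; exact: radius_iter1.
  rewrite /run_pair; congr pair; last exact: cc'.
  have runE w : run predT s (snd \o w) (fst \o w) h =
      iter (N - t) (run T pass (snd \o w)) (y t w) h.
    rewrite (@run_inside _ _ _ _ _ L i0 K1 O _ _ _ (fst \o w)); last first.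
      by move=> n nk; split=> //; exact: OO'.
    by rewrite run_nseq /y -iterD subnK// ltnW.
  by rewrite !runE it.
rewrite -nval_image.
pose D0 := [fset h in O | ch t z0 h]%fset.
apply: (Ym (snd \o z0) D0) => [||_ [z [[Xz Cz] /= [tz bz Dz]] <-]].
- by apply: CP; case: Zz0.
- by rewrite card_sep_fset -tz0; exact: ttP.
split.
  have : legal (fst \o z) by exact: XL.
  rewrite /y; elim: (t : nat) => [//|k IH] Lz; rewrite iterS; apply: run_legal.
  - exact: CP Cz.
  - exact: FFP.
  - exact: IH.
exists (snd \o z); split; first exact: CP.
  by apply/patternP; rewrite bz bz0.
move=> h hD0; apply/negP => chh; move/negP: hD0; apply.
have hO := changed_inside chh; rewrite mem_sep_fset hO /=.
have : [` hO]%fset \in Dl z by rewrite finset.inE /ch tz.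
by rewrite Dz -Dz0 finset.inE /= tz0.
Qed.

End Counting.

(** Expand the power of [1 + x] as a sum over all subsets: since [x <= 1], every set counted
    contributes at least [x ^+ k]. *)
Lemma card_small_sets (R : realType) (T : finType) (k : nat) (x : R) :
  0 < x <= 1 ->
  #|[pred D : {set T} | (#|D| <= k)%N]|%:R <= (1 + x) ^+ #|T| * x ^- k.
Proof.
move=> /andP[x0 x1]; rewrite ler_pdivlMr ?exprn_gt0//.
have -> : (1 + x) ^+ #|T| = \sum_(D : {set T}) x ^+ #|D|.
  rewrite addrC -prodr_const.
  rewrite (bigA_distr _ _ (fun _ : T => x) (fun=> 1))/=.
  by apply: eq_bigr => D _; rewrite -big_mkcond/= prodr_const.
rewrite mulr_natl -sumr_const [leRHS](bigID (fun D : {set T} => (#|D| <= k)%N))/=.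
rewrite -[leLHS]addr0 lerD//; last by apply: sumr_ge0 => D _; rewrite exprn_ge0// ltW.
by apply: ler_sum => D Dk; rewrite ler_wiXn2l// ltW.
Qed.

Lemma ln_card_small_sets (R : realType) (T : finType) (N b : nat) (x : R) :
  (0 < N)%N -> 0 < x <= 1 ->
  ln #|[pred D : {set T} | (N * #|D| <= b)%N]|%:R <=
    #|T|%:R * x - b%:R / N%:R * ln x.
Proof.
move=> N0 x01; have /andP[x0 x1] := x01; pose k := (b %/ N)%N.
have -> : #|[pred D : {set T} | (N * #|D| <= b)%N]| =
          #|[pred D : {set T} | (#|D| <= k)%N]|.
  by apply: eq_card => D; rewrite !inE leq_divRL// mulnC.
have c0 : (0 < #|[pred D : {set T} | (#|D| <= k)%N]|)%N.
  by apply/card_gt0P; exists finset.set0; rewrite inE cards0.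
apply: (@le_trans _ _ (ln ((1 + x) ^+ #|T| * x ^- k))).
  rewrite ler_ln ?posrE ?ltr0n ?card_small_sets//.
  by rewrite mulr_gt0 ?invr_gt0 ?exprn_gt0 ?addr_gt0.
rewrite lnM ?posrE ?invr_gt0 ?exprn_gt0 ?addr_gt0//.
rewrite lnV ?posrE ?exprn_gt0// !lnXn ?addr_gt0// -![ln _ *+ _]mulr_natl.
have lnx : ln x <= 0 by rewrite ln_le0.
have ln1x : ln (1 + x) <= x.
  have := @le_ln1Dx R x; apply; lra.
have kb : k%:R <= b%:R / N%:R :> R.
  by rewrite ler_pdivlMr ?ltr0n// -natrM ler_nat leq_trunc_div.
apply: lerB; first by rewrite ler_wpM2l.
by rewrite ler_wnM2r.
Qed.

Lemma expR_nat_bound (R : realType) (e : R) : 0 <= e ->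
  exists2 m : nat, ln (m%:R : R) <= e &
    forall n : nat, ln (n%:R : R) <= e -> (n <= m)%N.
Proof.
move=> e0; have E0 : 0 <= expR e by exact: expR_ge0.
have /andP[mE Em] := truncn_itv E0.
have m0 : (0 < Num.truncn (expR e))%N.
  by rewrite truncn_gt0 -expR0 ler_expR.
exists (Num.truncn (expR e)).
  by rewrite -[leRHS]expRK ler_ln ?posrE ?ltr0n ?expR_gt0.
case=> // n ne; rewrite -ltnS -(ltr_nat R); apply: le_lt_trans Em.
by rewrite -ler_ln ?posrE ?expR_gt0// expRK.
Qed.

(** * Small entropy after many passes *)

Section LowEntropy.
Variables (R : realType) (G : groupType) (S : {fset G}).
Hypotheses (genS : generates S) (amG : amenable S R).
Hypothesis infG : infinite_set [set: G].

(** A late Følner set: near invariance bounds the first summand and large cardinality the second, by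
    half of the right side each. *)
Lemma exists_window (K : {fset G}) (l d : R) : 0 <= l -> 0 < d ->
  exists2 F : {fset G}, F != fset0 &
    (#|` F `\` inside K F|%fset + #|` K|)%:R * l <= d * #|` F|%:R.
Proof.
move=> l0 d0; have [F folF] := amG.
have e0 : 0 < d / 2 / (l + 1) by rewrite !divr_gt0// ltr_pwDr.
pose m := Num.bound `|#|` K|%:R * l / (d / 2)|.
have [n [Hc Hm]] := filter_ex (filterI
  (folner_core genS folF (fmul (finv K) K) e0) (folner_card genS folF infG m)).
exists (F n); first exact: (proj1 folF).
rewrite natrD mulrDl.
have h1 : #|` F n `\` inside K (F n)|%fset%:R * l <= d / 2 * #|` F n|%:R.
  apply: (@le_trans _ _ (d / 2 / (l + 1) * #|` F n|%:R * l)); first by rewrite ler_wpM2r.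
  rewrite mulrAC ler_wpM2r// mulrAC ler_pdivrMr ?ltr_pwDr//.
  by rewrite ler_wpM2l ?divr_ge0 ?lerDl// ltW.
have h2 : #|` K|%:R * l <= d / 2 * #|` F n|%:R.
  rewrite [leRHS]mulrC -ler_pdivrMr ?divr_gt0//.
  by apply: le_trans (le_bound_norm _) _; rewrite ler_nat.
by lra.
Qed.

Section Passes.
Variables (A I : finType).
Variables (K F P : {fset G}) (L : set {ffun K -> A}) (i0 : I).
Hypotheses (K1 : (1%g \in K)) (F0 : F != fset0).
Hypothesis FFP : {subset fmul F (finv F) <= P}.
Hypothesis FFP' : {subset fmul (finv F) F <= P}.
Hypothesis WWP : {subset fmul (finv (window K F)) (window K F) <= P}.
Variables (X : set (config G A)) (C : set (config G I)).
Hypotheses (X0 : X !=set0) (C0 : C !=set0) (iC : shift_invariant_set C).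
Hypothesis XL : forall x, X x -> @legal G A K L x.
Hypothesis CP : forall c, C c -> proper P c.
Variable d : R.
Hypotheses (d01 : 0 < d < 1).
Hypothesis Fd : (#|` F `\` inside K F|%fset + #|` K|)%:R * ln #|A|%:R <= d * #|` F|%:R.
Hypothesis Cd : ent R C <= d.

(** Per site of [O], the logarithms of the four factors in [quiet_pass_count] are at most [d],
    [4 * d], [2 * d] and [4 * d]. As [O'] has at least half the size of [O], their sum [11 * d]
    becomes [22 * d]. *)
Lemma many_passes_low_entropy : exists N : nat,
  ent R (@run_pair _ _ _ K F L i0 (flatten (nseq N (enum I))) @`
          [set z | X (fst \o z) /\ C (snd \o z)]) <= 22 * d.
Proof.
have /andP[d0 d1] := d01; have [Fn folF] := amG.
pose l : R := ln #|A|%:R; have l0 : 0 <= l by exact: ln_natr_ge0.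
have A0 : (0 < #|A|)%N by have [x _] := X0; apply/card_gt0P; exists (x 1%g).
have lnd : ln d <= 0 by rewrite ln_le0// ltW.
pose f : R := #|` F|%:R.
have f0 : 0 < f by rewrite ltr0n cardfs_gt0.
pose k0 : R := f * (#|A| ^ #|I|.+1)%:R.
have k00 : 0 <= k0 by rewrite mulr_ge0.
(* [N] serves two estimates: the term [f * l] pays for windows meeting changed sites ([t2]), the
   term [- ln d] for the choice of the changed set ([small]). *)
pose N := (Num.bound `|k0 * (f * l - ln d) / d|).+1.
have fl0 : 0 <= f * l by rewrite mulr_ge0// ltW.
have NP : k0 * (f * l - ln d) <= d * N%:R.
  rewrite [leRHS]mulrC -ler_pdivrMr//; apply: le_trans (le_bound_norm _) _.
  by rewrite ler_nat.
have N0 : (0 < N%:R :> R) by rewrite ltr0n.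
have [V V0 Vd] : exists2 V, V != fset0 & ln (npat C V)%:R / #|` V|%:R < 2 * d.
  by apply: ent_lt => //; apply: (le_lt_trans Cd); lra.
pose rad := radius_iter K F (size (flatten (nseq N (enum I)))).
pose W' := (1%g |` (F `|` window K F))%fset.
have e0 : 0 < d / (l + 1) by rewrite !divr_gt0// ltr_pwDr.
have half0 : 0 < 2^-1 :> R by rewrite invr_gt0.
have [n [[[[Ha Hb] Hc] Hd] He]] := filter_ex (filterI (filterI (filterI (filterI
  (folner_fmul genS folF (finv F) (@ltr01 R))
  (folner_fmul genS folF (finv V) (@ltr01 R)))
  (folner_boundary genS folF W' e0))
  (folner_core genS folF rad half0))
  (folner_card genS folF infG (Num.bound `|ln N%:R / d : R|))).
set O := Fn n in Ha Hb Hc Hd He.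
pose o : R := #|` O|%:R.
have o0 : 0 < o by rewrite ltr0n cardfs_gt0 (proj1 folF).
have {}He : ln N%:R <= d * o.
  rewrite [leRHS]mulrC -ler_pdivrMr//; apply: le_trans (le_bound_norm _) _.
  by rewrite ler_nat.
have lnC : ln (npat C O)%:R <= 4 * d * o.
  have V0' : 0 < #|` V|%:R :> R by rewrite ltr0n cardfs_gt0.
  have := ln_npat_shearer R O iC C0 V0; rewrite mulrC -ler_pdivlMr// => /le_trans; apply.
  rewrite -[leLHS]mulrA; apply: (@le_trans _ _ (((1 + 1) * o) * (2 * d))); last by lra.
  by apply: ler_pM => //; [rewrite divr_ge0 ?ln_natr_ge0|exact: ltW].
pose J := [fset u in fmul O (finv F) | ~~ inside_of K F O u]%fset.
have JP : #|` J|%:R * l <= d * o.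
  have : #|` J|%:R <= d / (l + 1) * o.
    apply: Hc => h; rewrite mem_sep_fset => /andP[/fmulP[u uO [v vF hE]] /negP ni].
    rewrite mem_finv in vF; split.
      exists v^-1%g; first by rewrite !inE vF orbT.
      by rewrite hE mulgK.
    apply: contrapT => nk; apply: ni; apply/inside_ofP.
    have all k : k \in W' -> (h * k)%g \in O.
      by move=> kW; apply: contrapT => /negP hk; apply: nk; exists k.
    split; first by rewrite -(mulg1 h); apply: all; rewrite !inE eqxx.
    by move=> w wW; apply: all; rewrite !inE [_ \in window _ _]wW !orbT.
  move=> /(ler_wpM2r l0)/le_trans; apply.
  rewrite mulrAC ler_pM2r// mulrAC ler_pdivrMr ?ltr_pwDr//.
  by rewrite ler_wpM2l ?lerDl// ltW.
pose b := (#|` F| * (#|` O| * #|A| ^ #|I|.+1))%N.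
have bE : b%:R = k0 * o by rewrite /b !natrM /k0 /f /o; lra.
(* Of the [4 * d * o], two parts come from frozen sites, one from windows that leave [O] and one
   from windows that meet changed sites. *)
have [m mle mP] := @expR_nat_bound R (4 * d * o) (mulr_ge0 (mulr_ge0 (ler0n _ 4) (ltW d0)) (ltW o0)).
pose O' := core rad O.
have := @quiet_pass_count _ _ _ _ _ _ L i0 K1 FFP FFP' X C O O' N m XL CP isT.
set Xh := image _ _.
move=> count.
have {count} : (npat Xh O' <= N * npat C O * #|[pred D : {set O} | (N * #|D| <= b)%N]| * m)%N.
  apply: count; first by move=> h k /coreP[_ hr] kr; exact: hr.
  move=> c0 D Y c0P Db YP; apply: mP.
  have [->|Y0] := posnP (npat Y O); first by rewrite ln0// mulr_ge0 ?mulr_ge0 ?ltW.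
  have := @frozen_count R _ _ _ _ _ _ L i0 K1 F0 FFP FFP' WWP O c0 D Y (enum I) c0P (mem_enum I) YP.
  rewrite -/J; set ex := (_ + _ * (_ + _))%N => cnt.
  have : f * ln (npat Y O)%:R <= ex%:R * l.
    rewrite /f /l !mulr_natl -!lnXn ?ltr0n// -!natrX; apply: ler_ln_nat => //.
    by rewrite expn_gt0 Y0.
  move=> H; rewrite -(ler_pM2l f0); apply: (le_trans H).
  have exE : ex%:R = (#|` F `\` inside K F|%fset + #|` K|)%:R * #|` fmul O (finv F)|%:R +
      f * (#|` J|%:R + #|` D|%:R * f) :> R by rewrite /ex natrD 2!natrM (natrD _ #|` J|) natrM.
  rewrite exE mulrDl.
  have t1 : (#|` F `\` inside K F|%fset + #|` K|)%:R * #|` fmul O (finv F)|%:R * l <= d * f * ((1 + 1) * o).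
    by rewrite mulrAC; apply: ler_pM => //; rewrite mulr_ge0.
  have t2 : #|` D|%:R * f * l <= d * o.
    rewrite -(ler_pM2l N0).
    have : N%:R * #|` D|%:R <= k0 * o by rewrite -bE -natrM ler_nat.
    move=> /(ler_wpM2r fl0).
    have : k0 * (f * l) <= d * N%:R.
      by apply: le_trans NP; rewrite ler_wpM2l//; lra.
    move=> /(ler_wpM2r (ltW o0)).
    by lra.
  have t3 : f * (#|` J|%:R * l + #|` D|%:R * f * l) <= f * (2 * d * o).
    by rewrite ler_pM2l//; lra.
  by lra.
move=> count.
have Xh0 : Xh !=set0.
  have [x Xx] := X0; have [c Cc] := C0.
  exists (run_pair F L i0 (flatten (nseq N (enum I))) (fun g => (x g, c g))).
  by exists (fun g => (x g, c g)).
have small : ln #|[pred D : {set O} | (N * #|D| <= b)%N]|%:R <= 2 * d * o.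
  have dd : 0 < d <= 1 by rewrite d0 ltW.
  apply: le_trans (@ln_card_small_sets R O N b d isT dd) _.
  rewrite -cardfE -/o bE.
  have : k0 * o / N%:R * - ln d <= d * o.
    rewrite mulrAC ler_pdivrMr//.
    have : k0 * (- ln d) <= d * N%:R by apply: le_trans NP; rewrite ler_wpM2l//; lra.
    by move=> /(ler_wpM2r (ltW o0)); lra.
  by lra.
exists N; rewrite -/Xh.
have O'o : o / 2 <= #|` O'|%:R.
  have : o = #|` O'|%:R + #|` O `\` O'|%fset%:R.
    rewrite /o -natrD -[in LHS](cardfsID O') (_ : (O `&` O')%fset = O')//.
    apply/fsetIidPr/fsubsetP => h; by case/coreP.
  by rewrite -/O' -/o in Hd; lra.
have O'0 : O' != fset0.
  by rewrite -cardfs_gt0 -(ltr0n R); apply: lt_le_trans O'o; rewrite divr_gt0.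
apply: (le_trans (ent_le R Xh O'0)); rewrite ler_pdivrMr ?ltr0n ?cardfs_gt0//.
apply: (@le_trans _ _ (11 * d * o)); last first.
  have := ler_wpM2l (ltW d0) O'o; lra.
have cnt0 := leq_trans (npat_gt0 O' Xh0) count.
move: (cnt0); rewrite !muln_gt0 => /andP[/andP[/andP[_ C0'] s0'] m0'].
apply: (le_trans (ler_ln_nat R (npat_gt0 O' Xh0) count)).
rewrite !natrM !lnM ?posrE ?mulr_gt0 ?ltr0n//.
apply: le_trans (lerD (lerD (lerD He lnC) small) mle) _.
by clear small count cnt0 s0' m0' C0'; lra.
Qed.

End Passes.
End LowEntropy.

(** * Entropy lost in a single step *)

Section Approximation.
Variables (R : realType) (G : groupType) (S : {fset G}).
Hypotheses (genS : generates S) (amG : amenable S R).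

Lemma ent_mono (A B : finType) (X : set (config G A)) (Y : set (config G B)) :
  Y !=set0 -> (forall E, npat Y E <= npat X E)%N -> ent R Y <= ent R X.
Proof.
move=> Y0 YX; apply: ent_ge => E E0; apply: le_trans (ent_le R Y E0) _.
rewrite ler_pM2r ?invr_gt0 ?ltr0n ?cardfs_gt0//.
by apply: ler_ln_nat; rewrite ?npat_gt0.
Qed.

Lemma image_invariant (A B : finType) N (f : config G A -> config G B) (X : set (config G A)) :
  block_code N f -> shift_invariant_set X -> shift_invariant_set (f @` X).
Proof.
move=> fN iX g _ [x Xx <-]; exists (translate g x); first exact: iX.
exact: block_code_translate fN.
Qed.

Section Drop.
Variables (A I : finType).
Variables (K F P V : {fset G}) (L : set {ffun K -> A}) (i0 : I).
Hypothesis K1 : (1%g \in K).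
Let J := fmul V (finv F).
Hypothesis JJP : {subset fmul (finv J) J <= P}.
Variable Z : set (config G (A * I)%type).
Hypotheses (Z0 : Z !=set0) (iZ : shift_invariant_set Z).
Hypothesis ZP : forall z, Z z -> proper P (snd \o z).

Local Notation run_pair := (@run_pair G A I K F L i0).

(* Together with the configuration after a step of colour [i], this recovers the
   one before it; its entropy is small because points of one colour are sparse. *)
Definition overwritten (i : I) (z : config G (A * I)%type) : config G (option A) :=
  fun h => if [pick f : F | (z (h / val f)%g).2 == i] is Some _ then Some (z h).1 else None.

Lemma overwritten_code i : block_code (1%g |` finv F)%fset (overwritten i).
Proof.
move=> x y g h xy; rewrite /overwritten.
have -> : [pick f : F | (x (g / val f)%g).2 == i] = [pick f : F | (y (h / val f)%g).2 == i].
  apply: eq_pick => f /=; rewrite xy// !inE.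
  by rewrite mem_finv invgK fsvalP orbT.
case: pickP => // f _; have := xy 1%g; rewrite !inE eqxx !mulg1 => -> //.
Qed.

(** The centres of the translates of [F] that meet [V] lie in [J], where colour [i] occurs at most
    once. That centre and the letters on its translate of [F] determine the overwritten letters on
    [V]. *)
Lemma step_drop s i : V != fset0 ->
  ent R (run_pair s @` Z) <= ent R (run_pair (rcons s i) @` Z) +
    ln (#|` J| * #|A| ^ #|` F|).+1%:R / #|` V|%:R.
Proof.
move=> V0.
have [N sN] := @run_pair_code _ _ _ K F L i0 K1 s.
have [N' sN'] := @run_pair_code _ _ _ K F L i0 K1 (rcons s i).
have im0 (B : finType) (f : config G (A * I)%type -> config G B) : f @` Z !=set0.
  by have [z Zz] := Z0; exists (f z); exists z.
pose Ov := (overwritten i \o run_pair s) @` Z.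
have OvN := block_code_comp sN (overwritten_code i).
apply: (@le_trans _ _ (ent R (run_pair (rcons s i) @` Z) + ent R Ov)).
  apply: (ent_leD genS amG).
  - exact: image_invariant sN iZ.
  - exact: image_invariant sN' iZ.
  - exact: image_invariant OvN iZ.
  - exact: im0.
  - exact: im0.
  - exact: im0.
  move=> E; rewrite /npat !nval_image; apply: leq_trans (nval_pair _ _ _).
  have runS w h : run_pair (rcons s i) w h =
      (if [pick f : F | (w (h / val f)%g).2 == i] is Some f
       then (run_pair (rcons s i) w h).1 else (run_pair s w h).1, (w h).2).
    rewrite /run_pair /run -cats1 foldl_cat; congr pair => /=; rewrite /step.
    have -> : [pick f : F | (snd \o w) (h / val f)%g == i & predT (h / val f)%g] =
              [pick f : F | (w (h / val f)%g).2 == i].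
      by apply: eq_pick => f /=; rewrite andbT.
    by case: pickP.
  apply: leq_nval_fun => z z' _ _ [/patternP rz /patternP oz]; apply/patternP => h hE.
  move: (rz h hE) (oz h hE); rewrite (runS z) (runS z') /overwritten /=.
  move=> [stepE cE]; rewrite /run_pair cE => ovE; congr pair.
  move: stepE ovE; case: pickP => [f _|_]; case: pickP => [f' _|_]//.
  by move=> _ [].
rewrite lerD2l.
apply: (le_trans (ent_le _ _ V0)); rewrite ler_pM2r ?invr_gt0 ?ltr0n ?cardfs_gt0//.
apply: ler_ln_nat; first exact/npat_gt0/im0.
rewrite /npat nval_image.
pose g (z : config G (A * I)%type) : option (J * {ffun F -> A}) :=
  omap (fun u => (u, pattern F (view (val u) (fst \o run_pair s z))))
    [pick u : J | (z (val u)).2 == i].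
apply: (@leq_trans (nval Z g)); last first.
  apply: leq_trans (nval_le_card _ _) _.
  by rewrite card_option card_prod card_ffun -!cardfE.
have pickJ (z : config G (A * I)%type) h : h \in V -> forall f : F, (z (h / val f)%g).2 == i ->
    exists2 u : J, val u = (h / val f)%g & (z (val u)).2 == i.
  move=> hV f zf; have uJ : (h / val f)%g \in J.
    by apply: mem_fmul => //; rewrite mem_finv invgK; exact: fsvalP.
  by exists [` uJ]%fset.
have ovE z (u : J) h : Z z -> h \in V -> (z (val u)).2 = i ->
    overwritten i (run_pair s z) h =
    if ((val u)^-1 * h)%g \in F then Some (run_pair s z h).1 else None.
  move=> Zz hV zu; rewrite /overwritten; case: pickP => [f zf|nf].
    have [u' u'E zu'] := pickJ z h hV f zf.
    have -> : val u = val u'.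
      apply: (ZP Zz); last by rewrite /= zu (eqP zu').
      by apply: JJP; apply: mem_fmul; rewrite ?mem_finv ?invgK; exact: fsvalP.
    by rewrite u'E invgM invgK -mulgA mulVg mulg1 fsvalP.
  case: ifP => // uF; have := nf [` uF]%fset.
  by rewrite /= invgM invgK mulVKg zu eqxx.
apply: leq_nval_fun => z z' Zz Zz' gg'; apply/patternP => h hV /=.
move: gg'; rewrite /g; case: pickP => [u /eqP zu|nu]; case: pickP => [u' /eqP zu'|nu']//=.
  move=> [uu' /patternP zz']; rewrite -uu' in zu' zz' *.
  rewrite (ovE z u)// (ovE z' u)//; case: ifP => // uF.
  by have := zz' _ uF; rewrite /view !mulVKg /= => ->.
move=> _; rewrite /overwritten; case: pickP => [f zf|_].
  by have [u' _] := pickJ z h hV f zf; rewrite nu.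
case: pickP => [f zf|_//].
by have [u' _] := pickJ z' h hV f zf; rewrite nu'.
Qed.

End Drop.
End Approximation.

(** * Shifts of prescribed entropy *)

Lemma ivt_nat (R : realType) (h : nat -> R) (n : nat) (a : R) :
  a <= h 0%N -> h n < a -> exists2 k, (k < n)%N & a <= h k /\ h k.+1 < a.
Proof.
move=> h0; elim: n => [|n IH hn]; first by rewrite ltNge h0.
have [/IH[k kn hk]|an] := ltP (h n) a; last by exists n.
by exists k => //; exact: ltnW.
Qed.

Section Density.
Variables (R : realType) (G : groupType) (S : {fset G}).
Hypotheses (genS : generates S) (amG : amenable S R).
Hypothesis infG : infinite_set [set: G].
Variable FF : shift_class G.
Hypothesis stable : strongly_stable S FF.

Lemma approximate_entropy (A : finType) (X : subshift G A) (K : {fset G}) (a e : R) :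
  1%g \in K -> FF X -> shift_set X !=set0 -> 0 <= a -> a <= ent R X -> 0 < e ->
  exists Y : subshift G A, [/\ FF Y, patterns K Y = patterns K X,
    shift_set Y !=set0 & a <= ent R Y < a + e].
Proof.
move=> K1 FX X0 a0 aX e0.
(* Both the final bound [22 * d] and the overshoot [2 * d] at a crossing have to stay below [e]. *)
pose d := Num.min (e / 23) (1 / 2).
have d0 : 0 < d by rewrite lt_min !divr_gt0.
have de : 23 * d <= e.
  have : d <= e / 23 by rewrite ge_min lexx.
  by lra.
have d1 : d < 1.
  by apply: (@le_lt_trans _ _ (1 / 2)); [rewrite ge_min lexx orbT|lra].
have [F F0 Fd] := exists_window genS amG infG K (ln_natr_ge0 R #|A|) d0.
(* The count in [step_drop] is linear in the size of [V], so for large [V] one step loses at most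
   [d]. *)
have [v0 v0P] := ln_poly_small (1 + #|` F| * #|A| ^ #|` F|) 1 d0.
have [V _ Vv] := infinite_set_fset (maxn 1 v0) infG.
move: Vv; rewrite geq_max => /andP[V0 Vv].
have {}V0 : V != fset0 by rewrite -cardfs_gt0.
pose J := fmul V (finv F).
pose P := (fmul F (finv F) `|` fmul (finv F) F `|`
  fmul (finv (window K F)) (window K F) `|` fmul (finv J) J)%fset.
have [B [I [Z [N [f [SIZ Z0 fN fP fd]]]]]] := low_entropy_coloring genS amG P infG d0.
have FFP : {subset fmul F (finv F) <= P} by move=> g gP; rewrite !in_fsetU gP.
have FFP' : {subset fmul (finv F) F <= P} by move=> g gP; rewrite !in_fsetU gP orbT.
have WWP : {subset fmul (finv (window K F)) (window K F) <= P}.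
  by move=> g gP; rewrite !in_fsetU gP !orbT.
have JJP : {subset fmul (finv J) J <= P} by move=> g gP; rewrite !in_fsetU gP !orbT.
pose C := f @` Z.
have iC : shift_invariant_set C by exact: image_invariant fN (@shift_invariant _ _ Z).
have C0 : C !=set0 by have [z Zz] := Z0; exists (f z); exists z.
have CP c : C c -> proper P c by move=> [z Zz <-] g h; exact: fP.
(* With this colour distinguished, running the process on [x] and [c0] preserves the [K]-pattern of
   [x] at the identity, so no pattern of [X] is lost. *)
have [c0 Cc0] := C0; pose i0 := c0 1%g.
pose L := patterns K X.
have XL x : shift_set X x -> legal L x.
  move=> Xx g; exists (view g x) => //.
  have -> : view g x = translate g^-1%g x by apply/funext => h; rewrite /translate invgK.
  exact: shift_invariant.
pose W : set (config G (A * I)%type) := [set z | shift_set X (fst \o z) /\ C (snd \o z)].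
have W0 : W !=set0 by have [x Xx] := X0; exists (fun g => (x g, c0 g)).
have iW : shift_invariant_set W.
  by move=> g z [Xz Cz]; split; [exact: (shift_invariant g Xz)|exact: (iC g _ Cz)].
have WP z : W z -> proper P (snd \o z) by move=> [_ /CP].
pose rp := @run_pair _ _ _ K F L i0.
have im0 (B' : finType) (h : config G (A * I)%type -> config G B') : h @` W !=set0.
  by have [z Wz] := W0; exists (h z); exists z.
(* Computing the colours from [Z] inside the code makes the image a factor of the product of [X]
   with a strongly irreducible shift. *)
pose code s (z : config G (A * B)%type) : config G A :=
  fun g => (rp s (fun h => (fst (z h), f (snd \o z) h)) g).1.
have codeE s : exists M, block_code M (code s).
  have [M rpM] := @run_pair_code _ _ _ K F L i0 K1 s.
  exists (fmul M (1%g |` N)%fset) => x y g h xy; rewrite /code.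
  congr (_.1); apply: rpM => m mM.
  have xym n : n \in (1%g |` N)%fset -> x (g * m * n)%g = y (h * m * n)%g.
    by move=> nN; rewrite -!mulgA; apply: xy; exact: mem_fmul.
  congr pair; first by have := xym 1%g; rewrite !inE eqxx !mulg1 => ->.
  by apply: fN => n nN; rewrite /= xym// !inE nN orbT.
have exY s : exists Y : subshift G A, FF Y /\ shift_set Y = (fun z => fst \o z) @` (rp s @` W).
  have [M codeM] := codeE s; exists (code_image codeM (prod_shift X Z)); split.
    by apply: stable.1 (code_image_factor _ _); exact: stable.2.
  apply/seteqP; split=> [_ [z [Xz Zz] <-]|_ [_ [z [Xz [b Zb fb]] <-] <-]] /=.
    exists (rp s (fun h => (fst (z h), f (snd \o z) h))) => //.
    exists (fun h => (fst (z h), f (snd \o z) h)) => //; split => //=.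
    by exists (snd \o z).
  exists (fun h => ((z h).1, b h)); first by split.
  have zE : (fun h => ((z h).1, f b h)) = z.
    by apply/funext => h; rewrite fb /=; case: (z h).
  by apply/funext => g; rewrite -[in RHS]zE.
pose im s := (fun z : config G (A * I)%type => (fst \o z : config G A)) @` (rp s @` W).
have im0' s : im s !=set0 by have [w ww] := im0 _ (rp s); exists (fst \o w); exists w.
have im_le s : ent R (im s) <= ent R (rp s @` W).
  apply: ent_mono => // E; rewrite /npat nval_image; apply: leq_nval_fun => z z' _ _ /patternP zz'.
  by apply/patternP => g gE /=; rewrite zz'.
have iim s : shift_invariant_set (im s).
  have [M rpM] := @run_pair_code _ _ _ K F L i0 K1 s.
  apply: (@image_invariant _ _ _ [fset 1%g]%fset); last exact: image_invariant rpM iW.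
  by move=> x y g h xy /=; have := xy 1%g; rewrite inE eqxx !mulg1 => ->.
(* Forgetting the colours loses at most the entropy of [C]. *)
have im_ge s : ent R (rp s @` W) <= ent R (im s) + d.
  have [M rpM] := @run_pair_code _ _ _ K F L i0 K1 s.
  apply: (@le_trans _ _ (ent R (im s) + ent R C)); last by rewrite lerD2l.
  apply: (ent_leD genS amG (image_invariant rpM iW) (iim s) iC) => // E.
  apply: leq_trans (leq_nval_fun (g := fun w : config G (A * I)%type =>
    (pattern E (fst \o w : config G A), pattern E (snd \o w : config G I))) _) _.
    move=> z z' _ _ [/patternP zz1 /patternP zz2]; apply/patternP => g gE.
    by rewrite [LHS]surjective_pairing [RHS]surjective_pairing (zz1 g gE : _.1 = _) (zz2 g gE : _.2 = _).
  apply: leq_trans (nval_pair _ _ _) _; apply: leq_mul.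
    by rewrite /npat /im nval_image.
  rewrite -[leqLHS](nval_image (rp s @` W) (fun w => snd \o w) (pattern E)).
  by apply: leq_nval_sub => _ [_ [z [_ Cz] <-] <-].
have im_drop s i : ent R (rp s @` W) <= ent R (rp (rcons s i) @` W) + d.
  apply: le_trans (@step_drop R G S genS amG A I K F P V L i0 K1 JJP W W0 iW WP s i V0) _.
  rewrite lerD2l ler_pdivrMr ?ltr0n ?cardfs_gt0//.
  apply: le_trans (v0P _ Vv); apply: ler_ln_nat => //.
  have VF : (#|` J| <= #|` V| * #|` F|)%N by rewrite -(card_finv F) card_fmul.
  have V1 : (0 < #|` V|)%N by rewrite cardfs_gt0.
  rewrite expn1 mulnDl mul1n -add1n leq_add// mulnAC [X in (_ <= X * _)%N]mulnC.
  by rewrite leq_mul2r VF orbT.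
have imP s : patterns K (im s) = L.
  apply/seteqP; split=> [_ [_ [_ [z [Xz Cz] <-] <-] <-]|_ [x Xx <-]].
    have := @run_legal _ _ _ _ _ L i0 P _ (CP _ Cz) FFP predT s _ (XL _ Xz) 1%g.
    rewrite /view; congr (L _); apply/ffunP => k; rewrite !ffunE mul1g //.
  pose z : config G (A * I)%type := fun g => (x g, c0 g).
  exists (fst \o rp s z); first by exists (rp s z) => //; exists z.
  apply/patternP => k kK /=.
  have := @run_protected _ _ _ _ _ L i0 P _ (CP _ Cc0) FFP predT s x 1%g k (XL _ Xx) erefl kK.
  by rewrite !mul1g.
have im_nil : im [::] = shift_set X.
  apply/seteqP; split=> [_ [_ [z [Xz Cz] <-] <-]//|x Xx].
  by exists (fun g => (x g, c0 g)) => //; exists (fun g => (x g, c0 g)).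
have d01 : 0 < d < 1 by rewrite d0.
have [M Md] := @many_passes_low_entropy R G S genS amG infG A I K F P L i0 K1 F0 FFP FFP' WWP
  (shift_set X) C X0 C0 iC XL CP d d01 Fd fd.
set s := flatten _ in Md.
suff [s' s'e] : exists s', a <= ent R (im s') < a + e.
  have [Y [FY YE]] := exY s'; exists Y; split=> //; rewrite ?YE//.
  - exact: imP.
  - exact: im0'.
have [as_|sa] := leP a (ent R (im s)).
  exists s; rewrite as_ /=; apply: le_lt_trans (im_le s) _.
  by apply: (le_lt_trans Md); lra.
(* The last prefix before the entropy falls below [a] exceeds [a] by less than [2 * d]: one [d] for
   the step, one for the forgotten colours. *)
have [||k ks [ak ka]] := @ivt_nat R (fun k => ent R (im (take k s))) (size s) a.
- by rewrite /= take0 im_nil.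
- by rewrite /= take_size.
exists (take k s); rewrite ak /=.
apply: le_lt_trans (im_le _) _; apply: le_lt_trans (im_drop _ (nth i0 s k)) _.
rewrite -take_nth//; have := im_ge (take k.+1 s).
by move: ka; lra.
Qed.

End Density.

(** * Limits and category *)

Section Limits.
Variables (G : groupType) (A : finType).
Implicit Types (X Y Z : subshift G A) (E K : {fset G}).

Lemma patterns_sub K E (X Y : set (config G A)) : (E `<=` K)%fset ->
  patterns K X = patterns K Y -> patterns E X = patterns E Y.
Proof.
move=> /fsubsetP EK /hausdorff_patterns[/= XY YX]; apply/hausdorff_patterns.
by split=> /= u => [/XY|/YX] [v ? uv]; exists v => // g /EK; exact: uv.
Qed.

Lemma patterns_npat E (X Y : set (config G A)) :
  patterns E X = patterns E Y -> npat X E = npat Y E.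
Proof. by move=> XY; rewrite /npat /nval -!/(patterns E _) XY. Qed.

(** The limit consists of the configurations whose pattern on each [K n] occurs in [X n]. To realise
    a pattern of [x0] on [K n], choose points of the later [X m] that agree with [x0] there and take
    a cluster point. *)
Lemma limit_shift (X : nat -> subshift G A) (K : nat -> {fset G}) :
  (forall n, (K n `<=` K n.+1)%fset) ->
  (forall E, exists n, (E `<=` K n)%fset) ->
  (forall n, patterns (K n) (X n.+1) = patterns (K n) (X n)) ->
  exists Z : subshift G A, forall n, patterns (K n) Z = patterns (K n) (X n).
Proof.
move=> Kmono Kexh KX.
have Kle m n : (m <= n)%N -> (K m `<=` K n)%fset.
  move=> mn; rewrite -(subnKC mn); elim: (n - m)%N => [|k IH].
    by rewrite addn0 fsubset_refl.
  by rewrite addnS; exact: fsubset_trans IH (Kmono _).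
have KXle m n : (m <= n)%N -> patterns (K m) (X n) = patterns (K m) (X m).
  move=> mn; rewrite -(subnKC mn); elim: (n - m)%N => [|k IH]; first by rewrite addn0.
  rewrite addnS -IH; apply: (patterns_sub (K := K (m + k))); last exact: KX.
  by apply: Kle; rewrite leq_addr.
pose Z : set (config G A) := [set x | forall n, patterns (K n) (X n) (pattern (K n) x)].
have Zclosed : closed Z.
  move=> z clz n; have [w [Zw zw]] : Z `&` [set w | {in K n, z =1 w}] !=set0.
    by apply: clz; apply/nbhs_configP; exists (K n).
  by rewrite (proj2 (patternP (K n) z w) zw); exact: Zw.
have Zinv : shift_invariant_set Z.
  move=> g x Zx n; have [m gKm] := Kexh (lmul g^-1%g (K n)).
  have Km := fsubset_trans gKm (Kle m (maxn m n) (leq_maxl _ _)).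
  have [y Xy /patternP xy] := Zx (maxn m n).
  rewrite -(KXle n (maxn m n)) ?leq_maxr//.
  exists (translate g y); first exact: shift_invariant.
  apply/patternP => h hK; rewrite /translate xy//.
  by apply: (fsubsetP Km); rewrite mem_lmul invgK mulVKg.
exists (Shift Zclosed Zinv) => n; apply/seteqP; split=> [_ [z Zz <-]|_ [x0 Xx0 <-]] /=.
  exact: Zz.
have /choice[y yP] m : exists y, (n <= m)%N -> shift_set (X m) y /\ {in K n, y =1 x0}.
  have [nm|_] := leqP n m; last by exists x0.
  have : patterns (K n) (X m) (pattern (K n) x0) by rewrite KXle//; exists x0.
  by move=> [y Xy /patternP yx]; exists y.
have [x [_ clx]] := @compact_config G A (y m @[m --> \oo]) _ filterT.
have near k : exists2 m, (maxn n k <= m)%N & {in (K n `|` K k)%fset, x =1 y m}.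
  have yA : (y m @[m --> \oo]) (y @` [set m | (maxn n k <= m)%N]).
    by exists (maxn n k) => //= m km; exists m.
  have xB : nbhs x [set w | {in (K n `|` K k)%fset, x =1 w}].
    by apply/nbhs_configP; exists (K n `|` K k)%fset.
  by have [_ [[m km <-] xy]] := clx _ _ yA xB; exists m.
have xx0 : {in K n, x =1 x0}.
  have [m nm xy] := near n; have [_ yx0] := yP m (leq_trans (leq_maxl _ _) nm).
  by move=> g gK; rewrite xy ?yx0// in_fsetU gK.
exists x; last exact/patternP.
move=> k; have [m nkm xy] := near k.
have [Xy _] := yP m (leq_trans (leq_maxl _ _) nkm).
rewrite -(KXle k m) ?(leq_trans (leq_maxr n k))//; exists (y m) => //.
by apply/patternP => g gK; rewrite xy// in_fsetU gK orbT.
Qed.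

End Limits.

(** * Semicontinuity and the category argument *)

Section Generic.
Variables (R : realType) (G : groupType) (S : {fset G}) (A : finType).
Hypotheses (genS : generates S) (amG : amenable S R).
Hypothesis infG : infinite_set [set: G].
Hypothesis cG : countable [set: G].
Variable FF : shift_class G.
Hypothesis stable : strongly_stable S FF.

Lemma shifts_geP (c : R) (X : subshift G A) :
  shifts_ge S FF A c X <-> [/\ FF X, shift_set X !=set0 & c <= ent R X].
Proof.
split=> [[FX cX]|[FX X0 cX]]; last by split=> //; rewrite (entropyE genS amG)// lee_fin.
have X0 : shift_set X !=set0.
  by apply: contrapT => X0; move: cX; rewrite (entropy0 amG X0).
by split=> //; rewrite -lee_fin -(entropyE genS amG).
Qed.

Lemma patterns_neq0 K (X Y : set (config G A)) :
  patterns K X = patterns K Y -> X !=set0 -> Y !=set0.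
Proof.
move=> XY [x Xx]; have : patterns K Y (pattern K x) by rewrite -XY; exists x.
by move=> [y Yy _]; exists y.
Qed.

(** One finite set [E] witnesses the strict inequality, and any [Y] with the same patterns on [E]
    shares the witness. *)
Lemma ent_usc (X : set (config G A)) (b : R) : ent R X < b ->
  exists K : {fset G}, forall Y : set (config G A),
    patterns K X = patterns K Y -> ent R Y < b.
Proof.
move=> /ent_lt[E E0 Eb]; exists E => Y XY.
by apply: le_lt_trans (ent_le R Y E0) _; rewrite -(patterns_npat XY).
Qed.

Lemma nbhs_set_typeP (D : set (subshift G A)) (X : set_type D) (U : set (set_type D)) :
  nbhs X U -> exists2 K : {fset G}, 1%g \in K & forall Y : set_type D,
    patterns K (set_val X) = patterns K (set_val Y) -> U Y.
Proof.
move=> [_ [[V oV <-] VX VU]].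
have /nbhs_subshiftP[K KV] : nbhs (set_val X) V by exact: open_nbhs_nbhs.
exists (1%g |` K)%fset; first by rewrite !inE eqxx.
by move=> Y XY; apply/VU/KV/patterns_sub/XY; exact: fsubsetUr.
Qed.

Lemma set_type_nbhs (D : set (subshift G A)) (X : set_type D) (U : set (set_type D)) K :
  (forall Y : set_type D, patterns K (set_val X) = patterns K (set_val Y) -> U Y) ->
  nbhs X U.
Proof.
move=> KU; pose V := [set Y : subshift G A | patterns K (set_val X) = patterns K Y].
have VX : nbhs (set_val X) V by apply/nbhs_subshiftP; exists K.
have cont : continuous (set_val : set_type D -> subshift G A) by exact: initial_continuous.
exact: (filterS (fun Y => KU Y) (cont X V VX : nbhs X (set_val @^-1` V))).
Qed.

Section Level.
Variable c : R.
Hypothesis c0 : 0 <= c.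

Let T := set_type (@shifts_ge G R S FF A c).

Lemma dense_entropy_window (e : R) : 0 < e ->
  dense [set X : T | (c%:E <= entropy R S (set_val X) < (c + e)%:E)%E].
Proof.
move=> e0 U [X UX] oU; have [K K1 KU] := nbhs_set_typeP (open_nbhs_nbhs (conj oU UX)).
have [FX X0 cX] := proj1 (shifts_geP c _) (set_valP X).
have [Y [FY YX Y0 /andP[cY Yc]]] :=
  approximate_entropy genS amG infG stable K1 FX X0 c0 cX e0.
have geY : shifts_ge S FF A c Y by apply/shifts_geP.
exists (SigSub (mem_set geY)); split; first exact: KU.
by rewrite /= (entropyE genS amG Y0) lee_fin lte_fin cY.
Qed.

Lemma open_entropy_lt (b : R) : open [set X : T | (entropy R S (set_val X) < b%:E)%E].
Proof.
rewrite openE => X /= Xb; have [_ X0 _] := proj1 (shifts_geP c _) (set_valP X).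
move: Xb; rewrite (entropyE genS amG X0) lte_fin => /ent_usc[K KP].
apply: (set_type_nbhs (K := K)) => Y XY /=.
by rewrite (entropyE genS amG (patterns_neq0 XY X0)) lte_fin KP.
Qed.

Lemma exhaustion : exists B : nat -> {fset G},
  forall (E : {fset G}), exists n, forall m, (n <= m)%N -> (E `<=` B m)%fset.
Proof.
have /countable_injP[f finj] := cG.
have finB n : finite_set [set g : G | (f g <= n)%N].
  apply: (@finite_preimage _ _ [set m | (m <= n)%N] f).
    by move=> g h _ _; apply: finj; rewrite inE.
  exact: (finite_II n.+1).
exists (fun n => fset_set [set g : G | (f g <= n)%N]) => E.
exists (\max_(g <- E) f g) => m Em; apply/fsubsetP => g gE.
rewrite in_fset_set// inE /=; apply: leq_trans Em.
by rewrite (big_rem g)//= leq_maxl.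
Qed.

(** [M] is itself the dense Gdelta. For density, each stage keeps the patterns on the current finite
    set, lowers the entropy, and enlarges the finite set until its patterns force membership in
    [U n] and the entropy bound; the limit then has all these properties. *)
Lemma comeagre_entropy_level : Gdelta (@FF A) ->
  comeagre [set X : T | shifts_eq S FF A c (set_val X)].
Proof.
move=> [U oU FU]; pose M := [set X : T | shifts_eq S FF A c (set_val X)].
have ME : M = \bigcap_n [set X : T | (entropy R S (set_val X) < (c + n.+1%:R^-1)%:E)%E].
  apply/seteqP; split=> X.
    by move=> [_ Xc] n _; rewrite /= Xc lte_fin ltrDl invr_gt0.
  move=> Xn; have [FX X0 cX] := proj1 (shifts_geP c _) (set_valP X).
  split=> //; rewrite (entropyE genS amG X0); congr EFin; apply/eqP.
  rewrite eq_le cX andbT; apply/ler_addgt0Pr => e e0.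
  have := Xn (Num.bound e^-1) I; rewrite /= (entropyE genS amG X0) lte_fin => /ltW/le_trans; apply.
  rewrite lerD2l -[leRHS]invrK lef_pV2 ?posrE ?invr_gt0//.
  apply/ltW; apply: lt_trans (archi_boundP _) _; first by rewrite invr_ge0 ltW.
  by rewrite ltr_nat.
exists M; split=> //.
  exists (fun n => [set X : T | (entropy R S (set_val X) < (c + n.+1%:R^-1)%:E)%E]) => // n.
  exact: open_entropy_lt.
move=> W [X UX] oW; have [K0 K01 K0W] := nbhs_set_typeP (open_nbhs_nbhs (conj oW UX)).
have [FX X0 cX] := proj1 (shifts_geP c _) (set_valP X).
have [B Bexh] := exhaustion.
pose good (s : subshift G A * {fset G}) := [/\ shifts_ge S FF A c s.1 & 1%g \in s.2].
pose next n (s s' : subshift G A * {fset G}) := [/\ good s', patterns s.2 s'.1 = patterns s.2 s.1,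
  (s.2 `|` B n `<=` s'.2)%fset &
  forall Z : subshift G A, patterns s'.2 Z = patterns s'.2 s'.1 ->
    U n Z /\ ent R Z < c + n.+1%:R^-1].
have step n s : exists s', good s -> next n s s'.
  have [[/shifts_geP[Fs s0 cs] K1]|ns] := EM (good s); last by exists s.
  have n0 : (0 : R) < n.+1%:R^-1 by rewrite invr_gt0.
  have [Y [FY Ys Y0 /andP[cY Yc]]] := approximate_entropy genS amG infG stable K1 Fs s0 c0 cs n0.
  have [K KP] := ent_usc Yc.
  have /nbhs_subshiftP[K' K'P] : nbhs Y (U n).
    by apply: open_nbhs_nbhs; split=> //; move: FY; rewrite FU => /(_ n I).
  exists (Y, s.2 `|` B n `|` (K `|` K'))%fset => _; split => //=.
  - by split; [apply/shifts_geP|rewrite /= !in_fsetU K1].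
  - exact: fsubsetUl.
  - move=> Z ZY; split.
      apply: K'P; apply/esym/patterns_sub/ZY.
      by rewrite (fsubset_trans (fsubsetUr K K'))// fsubsetUr.
    apply: KP; apply/esym/patterns_sub/ZY.
    by rewrite (fsubset_trans (fsubsetUl K K'))// fsubsetUr.
have [g gP] : exists g, forall n s, good s -> next n s (g n s).
  have /choice[g gP] (p : nat * (subshift G A * {fset G})) :
      exists s', good p.2 -> next p.1 p.2 s'.
    exact: step.
  by exists (fun n s => g (n, s)) => n s; exact: (gP (n, s)).
pose s := fix s n := if n is n'.+1 then g n' (s n') else (set_val X, K0).
have sgood n : good (s n).
  elim: n => [|n IH] /=; last by have [] := gP n _ IH.
  by split=> //; exact: set_valP.
have snext n : next n (s n) (s n.+1) by exact: gP.
have [Z ZP] : exists Z : subshift G A,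
    forall n, patterns (s n).2 Z = patterns (s n).2 (s n).1.
  apply: (@limit_shift _ _ (fun n => (s n).1) (fun n => (s n).2)).
  - move=> n; have [_ _ + _] := snext n.
    exact: fsubset_trans (fsubsetUl _ _).
  - move=> E; have [n nE] := Bexh E; exists n.+1.
    have [_ _ + _] := snext n; apply: fsubset_trans.
    exact: fsubset_trans (nE n (leqnn n)) (fsubsetUr _ _).
  - by move=> n; have [_ + _ _] := snext n.
have Zn n : U n Z /\ ent R Z < c + n.+1%:R^-1.
  by have [_ _ _] := snext n; apply.
have Z0 : shift_set Z !=set0 by exact: (patterns_neq0 (esym (ZP 0%N)) X0).
have FZ : FF Z by rewrite FU => n _; case: (Zn n).
(* On each finite [E] the limit has the patterns of some stage, whose entropy is at least [c]; the
   infimum inherits the bound. *)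
have cZ : c <= ent R Z.
  apply: ent_ge => E E0; have [n nE] := Bexh E.
  have En : (E `<=` (s n.+1).2)%fset.
    have [_ _ + _] := snext n; apply: fsubset_trans.
    exact: fsubset_trans (nE n (leqnn n)) (fsubsetUr _ _).
  rewrite (patterns_npat (patterns_sub En (ZP n.+1))).
  have [/shifts_geP[_ _ cs] _] := sgood n.+1.
  exact: le_trans cs (ent_le R _ E0).
have geZ : shifts_ge S FF A c Z by apply/shifts_geP.
exists (SigSub (mem_set geZ)); split; first by apply: K0W; exact/esym/(ZP 0%N).
rewrite -/M ME => n _ /=; rewrite (entropyE genS amG Z0) lte_fin.
by case: (Zn n).
Qed.

End Level.
End Generic.

Theorem theorem1p5 (R : realType) (G : groupType) (S : {fset G}) (A : finType)
    (F : shift_class G) :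
  countable [set: G] -> infinite_set [set: G] ->
  generates S -> amenable S R -> strongly_stable S F ->
  (Gdelta (F A) ->
     forall c : R, 0 <= c ->
     comeagre [set X : set_type (shifts_ge S F A c) |
                 shifts_eq S F A c (set_val X)]) /\
  (forall c eps : R, 0 <= c -> 0 < eps ->
     dense [set X : set_type (shifts_ge S F A c) |
              (c%:E <= entropy R S (set_val X) < (c + eps)%:E)%E]).
Proof.
move=> cG infG genS amG stable; split=> [FG c c0|c eps c0 e0].
  exact: comeagre_entropy_level.
exact: dense_entropy_window.
Qed.
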